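(* Let $M(\phi,\xi,\eta,g_M)$ be a Kenmotsu manifold of dimension $2m+1$ and $(N,g_N)$ a Riemannian manifold of dimension $n$. Let $F:M(\phi,\xi,\eta,g_M)\to(N,g_N)$ be an anti-invariant Riemannian submersion such that the characteristic vector field $\xi$ is horizontal. Then the following assertions are equivalent to each other: (i) $(\ker F_* )^\perp$ defines a totally geodesic foliation on $M$; (ii) $g_M(\mathcal{A}_XBY,\phi V)=g_M(CY,\phi\mathcal{A}_XV)$ for all $X,Y\in\Gamma((\ker F_* )^\perp)$ and $V\in\Gamma(\ker F_* )$; (iii) $g_N((\nabla F_* )(X,\phi Y),F_*\phi V)=-g_M(CY,\phi\mathcal{A}_XV)$ for all $X,Y\in\Gamma((\ker F_* )^\perp)$ and $V\in\Gamma(\ker F_* )$.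
   Context: An almost contact metric structure $(\phi,\xi,\eta,g)$ on a connected $(2m+1)$-dimensional differentiable manifold $M$ consists of a $(1,1)$-tensor field $\phi$, a vector field $\xi$ (the characteristic vector field), a $1$-form $\eta$ and a Riemannian metric $g$ with $\phi^2=-I+\eta\otimes\xi$, $\phi\xi=0$, $\eta\circ\phi=0$, $\eta(\xi)=1$, $g(\phi X,\phi Y)=g(X,Y)-\eta(X)\eta(Y)$, $g(\phi X,Y)+g(X,\phi Y)=0$ and $\eta(X)=g(X,\xi)$ for all vector fields $X,Y$. It is a Kenmotsu manifold if $(\nabla_X\phi)Y=g(\phi X,Y)\xi-\eta(Y)\phi X$ for all $X,Y$, with $\nabla$ the Levi-Civita connection of $g$. A Riemannian submersion $F:(M,g_M)\to(N,g_N)$ is a smooth surjective map of maximal rank (i.e. $F_*$ is surjective at every point) such that $F_*$ preserves the lengths of horizontal vectors; vertical vectors are those in $\ker F_*$, horizontal vectors those in $(\ker F_* )^\perp$, and $\mathcal{V},\mathcal{H}$ denote the orthogonal projections onto these distributions. It is anti-invariant if $\phi(\ker F_* )\subseteq(\ker F_* )^\perp$. Let $\mu$ be the orthogonal complement of $\phi(\ker F_* )$ in $(\ker F_* )^\perp$. For horizontal $X$ write $\phi X=BX+CX$ with $BX\in\Gamma(\ker F_* )$ and $CX\in\Gamma(\mu)$ (so $BX,CX$ are the vertical and horizontal parts of $\phi X$). O'Neill's tensor $\mathcal{A}$ is $\mathcal{A}_EG=\mathcal{V}\nabla_{\mathcal{H}E}\mathcal{H}G+\mathcal{H}\nabla_{\mathcal{H}E}\mathcal{V}G$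 for vector fields $E,G$ on $M$, with $\nabla$ the Levi-Civita connection of $g_M$. The second fundamental form of $F$ is $(\nabla F_* )(X,Y)=\nabla^F_XF_*(Y)-F_*(\nabla_XY)$, where $\nabla^F$ is the pullback connection on $F^{-1}TN$. A distribution $D$ on $M$ defines a totally geodesic foliation if $\nabla_XY\in\Gamma(D)$ for all $X,Y\in\Gamma(D)$. *)

(* Defs.v *)
From HB Require Import structures.
From mathcomp Require Import all_boot all_order all_algebra.
From mathcomp Require Import all_classical all_reals all_analysis.

Set Implicit Arguments.
Unset Strict Implicit.
Unset Printing Implicit Defensive.

Import Order.TTheory GRing.Theory Num.Theory.
Import numFieldNormedType.Exports.

Local Open Scope classical_set_scope.
Local Open Scope ring_scope.

(* [f] is of class C^k on the open set [O]; the values of [f] outside [O] play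
   no role.  In finite dimension the differential of [f] is of class C^k iff
   all directional derivatives are. *)
Fixpoint Ck_on (R : realType) (V W : normedModType R) (k : nat) (O : set V)
    (f : V -> W) : Prop :=
  if k is k'.+1 then
    (forall x, O x -> differentiable f x) /\
    (forall v, Ck_on k' O (fun x => 'D_v f x))
  else forall x, O x -> {for x, continuous f}.

Definition smooth_on (R : realType) (V W : normedModType R) (O : set V)
    (f : V -> W) : Prop :=
  forall k, Ck_on k O f.

(* The smooth structure is given by an atlas in which a chart around each point
   is singled out: [chart a], with domain [dom a], is a chart around [a].  The
   maps [chart a] and [chart_inv a] are total, but only their restrictions to
   [dom a] and to [chart a @` dom a] are meaningful. *)
Record manifold (R : realType) (d : nat) := Manifold {
  space :> topologicalType;
  hausdorff_manifold : hausdorff_space space;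
  second_countable_manifold : @second_countable space;
  dom : space -> set space;
  chart : space -> space -> 'rV[R]_d;
  chart_inv : space -> 'rV[R]_d -> space;
  dom_center : forall a, dom a a;
  dom_open : forall a, open (dom a);
  chart_open : forall a, open (chart a @` dom a);
  chartK : forall a p, dom a p -> chart_inv a (chart a p) = p;
  chart_continuous :
    forall a p, dom a p -> {for p, continuous (chart a)};
  chart_inv_continuous :
    forall a p, dom a p -> {for chart a p, continuous (chart_inv a)};
  chart_compatible : forall a b,
    smooth_on (chart a @` (dom a `&` dom b)) (chart b \o chart_inv a) }.

Definition smooth_fun (R : realType) (d : nat) (M : manifold R d)
    (f : M -> R) : Prop :=
  forall a : M, smooth_on (chart a @` dom a) (f \o chart_inv a : _ -> R^o).

Definition smooth_map (R : realType) (d n : nat) (M : manifold R d)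
    (N : manifold R n) (F : M -> N) : Prop :=
  continuous F /\
  forall (a : M) (b : N),
    smooth_on (chart a @` (dom a `&` F @^-1` dom b))
              (chart b \o F \o chart_inv a).

(* The tangent space at [p] is 'rV[R]_d: a tangent vector at [p] is given by
   its components in the preferred chart [chart p].  [dirder p v h] is the
   derivative of [h : M -> W] along the tangent vector [v] at [p]; in particular
   [dirder p v (chart a)] is the row of components of [v] in [chart a]. *)
Definition dirder (R : realType) (d : nat) (M : manifold R d)
    (W : normedModType R) (p : M) (v : 'rV[R]_d) (h : M -> W) : W :=
  'D_v (h \o chart_inv p) (chart p p).

(* F_* at the point [p] *)
Definition push (R : realType) (d n : nat) (M : manifold R d)
    (N : manifold R n) (F : M -> N) (p : M) (v : 'rV[R]_d) : 'rV[R]_n :=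
  dirder p v (chart (F p) \o F).

(* [s] is a smooth section of the pullback bundle F^{-1}TN, where [s p] is
   a tangent vector of N at [F p]. *)
Definition smooth_along (R : realType) (d n : nat) (M : manifold R d)
    (N : manifold R n) (F : M -> N) (s : M -> 'rV[R]_n) : Prop :=
  forall (a : M) (b : N),
    smooth_on (chart a @` (dom a `&` F @^-1` dom b))
      (fun y => let p := chart_inv a y in dirder (F p) (s p) (chart b)).

(* Vector fields are the sections along the identity. *)
Definition smooth_field (R : realType) (d : nat) (M : manifold R d)
    (X : M -> 'rV[R]_d) : Prop :=
  smooth_along (idfun : M -> M) X.

(* The function X f *)
Definition lie (R : realType) (d : nat) (M : manifold R d)
    (X : M -> 'rV[R]_d) (f : M -> R) (p : M) : R :=
  dirder p (X p) (f : M -> R^o).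

Record riemannian_metric (R : realType) (d : nat) (M : manifold R d)
    (g : M -> 'rV[R]_d -> 'rV[R]_d -> R) : Prop := RiemannianMetric {
  metric_sym : forall p u v, g p u v = g p v u;
  metric_linear : forall p (c : R) u v w,
    g p (c *: u + v) w = c * g p u w + g p v w;
  metric_pos : forall p u, u != 0 -> 0 < g p u u;
  metric_smooth : forall X Y, smooth_field X -> smooth_field Y ->
    smooth_fun (fun p => g p (X p) (Y p)) }.

(* Linear connections on F^{-1}TN.  A connection is a total operator on maps;
   only its values on smooth sections are constrained. *)
Record connection_along (R : realType) (d n : nat) (M : manifold R d)
    (N : manifold R n) (F : M -> N)
    (nabla : (M -> 'rV[R]_d) -> (M -> 'rV[R]_n) -> M -> 'rV[R]_n) : Prop :=
  ConnectionAlong {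
  conn_smooth : forall X s, smooth_field X -> smooth_along F s ->
    smooth_along F (nabla X s);
  conn_addl : forall X Y s, smooth_field X -> smooth_field Y ->
    smooth_along F s -> forall p,
    nabla (fun q => X q + Y q) s p = nabla X s p + nabla Y s p;
  conn_scalel : forall f X s, smooth_fun f -> smooth_field X ->
    smooth_along F s -> forall p,
    nabla (fun q => f q *: X q) s p = f p *: nabla X s p;
  conn_addr : forall X s t, smooth_field X -> smooth_along F s ->
    smooth_along F t -> forall p,
    nabla X (fun q => s q + t q) p = nabla X s p + nabla X t p;
  conn_leibniz : forall f X s, smooth_fun f -> smooth_field X ->
    smooth_along F s -> forall p,
    nabla X (fun q => f q *: s q) p = lie X f p *: s p + f p *: nabla X s p }.

Record levi_civita (R : realType) (d : nat) (M : manifold R d)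
    (g : M -> 'rV[R]_d -> 'rV[R]_d -> R)
    (nabla : (M -> 'rV[R]_d) -> (M -> 'rV[R]_d) -> M -> 'rV[R]_d) : Prop :=
  LeviCivita {
  lc_connection : connection_along (idfun : M -> M) nabla;
  lc_metric : forall X Y Z, smooth_field X -> smooth_field Y ->
    smooth_field Z -> forall p,
    lie X (fun q => g q (Y q) (Z q)) p =
    g p (nabla X Y p) (Z p) + g p (Y p) (nabla X Z p);
  (* nabla_X Y - nabla_Y X = [X, Y], as derivations of smooth functions *)
  lc_torsion_free : forall X Y f, smooth_field X -> smooth_field Y ->
    smooth_fun f -> forall p,
    lie (nabla X Y) f p - lie (nabla Y X) f p =
    lie X (lie Y f) p - lie Y (lie X f) p }.

(* The pullback of [nablaN] is the connection on F^{-1}TN with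
   nablaF_X (Z o F) = nablaN_{F_* X} Z.  As F_* X is only a section along F, the
   right-hand side at [p] is computed with any field W on N that takes the value
   F_* X_p at [F p]. *)
Record pullback_connection (R : realType) (d n : nat) (M : manifold R d)
    (N : manifold R n) (F : M -> N)
    (nablaN : (N -> 'rV[R]_n) -> (N -> 'rV[R]_n) -> N -> 'rV[R]_n)
    (nablaF : (M -> 'rV[R]_d) -> (M -> 'rV[R]_n) -> M -> 'rV[R]_n) : Prop :=
  PullbackConnection {
  pb_connection : connection_along F nablaF;
  pb_compatible : forall X W Z, smooth_field X -> smooth_field W ->
    smooth_field Z -> forall p, W (F p) = push F p (X p) ->
    nablaF X (Z \o F) p = nablaN W Z (F p) }.

Definition second_fundamental_form (R : realType) (d n : nat)
    (M : manifold R d) (N : manifold R n) (F : M -> N)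
    (nablaM : (M -> 'rV[R]_d) -> (M -> 'rV[R]_d) -> M -> 'rV[R]_d)
    (nablaF : (M -> 'rV[R]_d) -> (M -> 'rV[R]_n) -> M -> 'rV[R]_n)
    (X Y : M -> 'rV[R]_d) (p : M) : 'rV[R]_n :=
  nablaF X (fun q => push F q (Y q)) p - push F p (nablaM X Y p).

Definition section_of (R : realType) (d : nat) (M : manifold R d)
    (D : M -> set 'rV[R]_d) (X : M -> 'rV[R]_d) : Prop :=
  smooth_field X /\ forall p, D p (X p).

Definition orth (R : realType) (d : nat) (M : manifold R d)
    (g : M -> 'rV[R]_d -> 'rV[R]_d -> R) (D : M -> set 'rV[R]_d) (p : M) :
    set 'rV[R]_d :=
  [set v | forall u, D p u -> g p v u = 0].

(* Orthogonal projection onto [D]: the w in D_p such that v - w is orthogonal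
   to D_p. *)
Definition orth_proj (R : realType) (d : nat) (M : manifold R d)
    (g : M -> 'rV[R]_d -> 'rV[R]_d -> R) (D : M -> set 'rV[R]_d) (p : M)
    (v : 'rV[R]_d) : 'rV[R]_d :=
  xget 0 [set w | D p w /\ orth g D p (v - w)].

Definition totally_geodesic_foliation (R : realType) (d : nat)
    (M : manifold R d)
    (nabla : (M -> 'rV[R]_d) -> (M -> 'rV[R]_d) -> M -> 'rV[R]_d)
    (D : M -> set 'rV[R]_d) : Prop :=
  forall X Y, section_of D X -> section_of D Y -> section_of D (nabla X Y).

Definition vertical (R : realType) (d n : nat) (M : manifold R d)
    (N : manifold R n) (F : M -> N) (p : M) : set 'rV[R]_d :=
  [set v | push F p v = 0].

Definition horizontal (R : realType) (d n : nat) (M : manifold R d)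
    (N : manifold R n) (g : M -> 'rV[R]_d -> 'rV[R]_d -> R) (F : M -> N) :
    M -> set 'rV[R]_d :=
  orth g (vertical F).

Record riemannian_submersion (R : realType) (d n : nat) (M : manifold R d)
    (N : manifold R n) (gM : M -> 'rV[R]_d -> 'rV[R]_d -> R)
    (gN : N -> 'rV[R]_n -> 'rV[R]_n -> R) (F : M -> N) : Prop :=
  RiemannianSubmersion {
  subm_smooth : smooth_map F;
  subm_surj : forall q : N, exists p : M, F p = q;
  subm_rank : forall (p : M) (w : 'rV[R]_n), exists v, push F p v = w;
  subm_isometry : forall (p : M) (v : 'rV[R]_d), horizontal gM F p v ->
    gN (F p) (push F p v) (push F p v) = gM p v v }.

Definition Vproj (R : realType) (d n : nat) (M : manifold R d)
    (N : manifold R n) (g : M -> 'rV[R]_d -> 'rV[R]_d -> R) (F : M -> N)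
    (X : M -> 'rV[R]_d) : M -> 'rV[R]_d :=
  fun p => orth_proj g (vertical F) p (X p).

Definition Hproj (R : realType) (d n : nat) (M : manifold R d)
    (N : manifold R n) (g : M -> 'rV[R]_d -> 'rV[R]_d -> R) (F : M -> N)
    (X : M -> 'rV[R]_d) : M -> 'rV[R]_d :=
  fun p => orth_proj g (horizontal g F) p (X p).

Definition oneillA (R : realType) (d n : nat) (M : manifold R d)
    (N : manifold R n) (g : M -> 'rV[R]_d -> 'rV[R]_d -> R) (F : M -> N)
    (nabla : (M -> 'rV[R]_d) -> (M -> 'rV[R]_d) -> M -> 'rV[R]_d)
    (E G : M -> 'rV[R]_d) : M -> 'rV[R]_d :=
  fun p => Vproj g F (nabla (Hproj g F E) (Hproj g F G)) p
         + Hproj g F (nabla (Hproj g F E) (Vproj g F G)) p.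

Record almost_contact_metric (R : realType) (m : nat)
    (M : manifold R m.*2.+1)
    (phi : M -> {linear 'rV[R]_(m.*2.+1) -> 'rV[R]_(m.*2.+1)})
    (xi : M -> 'rV[R]_(m.*2.+1))
    (eta : M -> {linear 'rV[R]_(m.*2.+1) -> R^o})
    (g : M -> 'rV[R]_(m.*2.+1) -> 'rV[R]_(m.*2.+1) -> R) : Prop :=
  AlmostContactMetric {
  acm_phi_smooth :
    forall X, smooth_field X -> smooth_field (fun p => phi p (X p));
  acm_xi_smooth : smooth_field xi;
  acm_eta_smooth :
    forall X, smooth_field X -> smooth_fun (fun p => eta p (X p));
  acm_metric : riemannian_metric g;
  acm_phi2 : forall p u, phi p (phi p u) = - u + eta p u *: xi p;
  acm_phi_xi : forall p, phi p (xi p) = 0;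
  acm_eta_phi : forall p u, eta p (phi p u) = 0;
  acm_eta_xi : forall p, eta p (xi p) = 1;
  acm_compat : forall p u v,
    g p (phi p u) (phi p v) = g p u v - eta p u * eta p v;
  acm_skew : forall p u v, g p (phi p u) v + g p u (phi p v) = 0;
  acm_eta_dual : forall p u, eta p u = g p u (xi p) }.

Record kenmotsu (R : realType) (m : nat) (M : manifold R m.*2.+1)
    (phi : M -> {linear 'rV[R]_(m.*2.+1) -> 'rV[R]_(m.*2.+1)})
    (xi : M -> 'rV[R]_(m.*2.+1))
    (eta : M -> {linear 'rV[R]_(m.*2.+1) -> R^o})
    (g : M -> 'rV[R]_(m.*2.+1) -> 'rV[R]_(m.*2.+1) -> R)
    (nabla : (M -> 'rV[R]_(m.*2.+1)) -> (M -> 'rV[R]_(m.*2.+1)) ->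
             M -> 'rV[R]_(m.*2.+1)) : Prop :=
  Kenmotsu {
  ken_connected : connected [set: M];
  ken_acm : almost_contact_metric phi xi eta g;
  ken_lc : levi_civita g nabla;
  (* (nabla_X phi) Y = nabla_X (phi Y) - phi (nabla_X Y) *)
  ken_nabla_phi : forall X Y, smooth_field X -> smooth_field Y -> forall p,
    nabla X (fun q => phi q (Y q)) p - phi p (nabla X Y p) =
    g p (phi p (X p)) (Y p) *: xi p - eta p (Y p) *: phi p (X p) }.

Definition anti_invariant (R : realType) (d n : nat) (M : manifold R d)
    (N : manifold R n) (phi : M -> {linear 'rV[R]_d -> 'rV[R]_d})
    (g : M -> 'rV[R]_d -> 'rV[R]_d -> R) (F : M -> N) : Prop :=
  forall p v, vertical F p v -> horizontal g F p (phi p v).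

(* B X and C X are the vertical and horizontal parts of phi X; for an
   anti-invariant submersion C X is orthogonal to phi (ker F_* ), i.e. lies in
   the complement of phi (ker F_* ) in the horizontal distribution. *)
Definition Bpart (R : realType) (d n : nat) (M : manifold R d)
    (N : manifold R n) (phi : M -> {linear 'rV[R]_d -> 'rV[R]_d})
    (g : M -> 'rV[R]_d -> 'rV[R]_d -> R) (F : M -> N)
    (X : M -> 'rV[R]_d) : M -> 'rV[R]_d :=
  Vproj g F (fun p => phi p (X p)).

Definition Cpart (R : realType) (d n : nat) (M : manifold R d)
    (N : manifold R n) (phi : M -> {linear 'rV[R]_d -> 'rV[R]_d})
    (g : M -> 'rV[R]_d -> 'rV[R]_d -> R) (F : M -> N)
    (X : M -> 'rV[R]_d) : M -> 'rV[R]_d :=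
  Hproj g F (fun p => phi p (X p)).

(* Main.v *)
From HB Require Import structures.
Require Import Defs.
From mathcomp Require Import all_boot all_order all_algebra.
From mathcomp Require Import all_classical all_reals all_analysis.
From mathcomp Require Import ring lra.
Import Order.TTheory GRing.Theory Num.Theory.
Import numFieldNormedType.Exports.
Local Open Scope classical_set_scope.
Local Open Scope ring_scope.
Set Implicit Arguments.
Unset Strict Implicit.
Unset Printing Implicit Defensive.

(** Fix horizontal fields X, Y, a vertical field V, and write B Y and C Y for
    the vertical and horizontal parts of phi Y.  Since xi is horizontal,
    eta V = 0, and the Kenmotsu identity differentiates phi up to terms that
    are orthogonal to phi V; hence (nabla_phi)
      g (nabla_X (phi Y)) (phi V) = g (nabla_X Y) V.
    The left-hand side splits along phi Y = B Y + C Y.  The B-part is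
    g (A_X B Y) (phi V) (oneillA_Bpart).  The C-part is - g (C Y) (phi A_X V),
    because C Y is orthogonal to phi V and to xi (oneillA_V).  So (ii) says
    that g (nabla_X Y) V vanishes for all X, Y and V, which is (i)
    (totally_geodesic_metric).  For (iii), F_* (phi Y) = F_* (C Y), and the
    second fundamental form of a Riemannian submersion vanishes on horizontal
    fields (second_fundamental_form_horizontal); what remains of
    (nabla F_* )(X, phi Y) is - F_* (nabla_X B Y), so that the left-hand side
    of (iii) is - g (A_X B Y) (phi V).

    This computation differentiates B Y and C Y, and the axioms of a connection
    only apply to smooth global sections.  Most of the work is therefore to
    prove that the vertical projection of a smooth field is smooth
    (smooth_Vproj).  Locally the projection is obtained by solving a linear
    system whose coefficients are the values of the metric and of F_* on a
    frame.  As the metric is known to be smooth on global fields only, the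
    frame has to consist of global fields, which requires bump functions, and
    thus a smooth function on the line that vanishes exactly on a half-line
    (flat, manifold_bump, frame).

    The vanishing of (nabla F_* )(X, Y) on horizontal fields follows without
    basic fields.  The pullback connection is compatible with the metric
    (pullback_metric) and torsion free (second_fundamental_form_sym), both by
    tensoriality: an expression that is linear over functions in a section
    along F depends on its value at the point only, and can be computed with
    the restriction of a field of N (tensor_eq).  Consequently
    g_N ((nabla F_* )(X, Y)) (F_* Z) is symmetric in X, Y and skew in Y, Z,
    hence zero. *)

(** * Calculus on open sets *)

(** The difference g - f vanishes near x, so that its differential is 0. *)
Lemma near_eq_differentiable (R : realType) (V W : normedModType R)
    (f g : V -> W) (x : V) :
  (\near x, f x = g x) -> differentiable f x -> differentiable g x.
Proof.
move=> fg df.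
suff dh : differentiable (g - f) x.
  by rewrite -(subrK f g); exact: differentiableD.
have e0 : (g - f) \o shift x = cst ((g - f) x) + (0 : V -> W) +o_ 0 id.
  rewrite -[_ + 0]/(cst ((g - f) x) + cst (0 : W)).
  apply/eqaddoP => e e0.
  have fg0 : \forall z \near 0, f (z + x) = g (z + x).
    by move: fg; rewrite (near_shift 0) /= subr0.
  near=> y.
  have -> : ((g - f) \o shift x - (cst ((g - f) x) + cst 0)) y = 0.
    rewrite -[LHS]/((g (y + x) - f (y + x)) - ((g x - f x) + 0)).
    by rewrite (near fg0 y) // (nbhs_singleton fg) !subrr addr0 subrr.
  by rewrite normr0 mulr_ge0 // ltW.
have d0 := @diff_cst _ V W 0 x.
have c0 : continuous ('d (cst (0 : W)) x : V -> W).
  by rewrite d0; exact: cst_continuous.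
have dE : 'd (g - f) x = 'd (cst (0 : W)) x :> (V -> W).
  by apply: diff_unique; [exact: c0|rewrite d0; exact: e0].
by apply/diff_locallyP; rewrite dE; split; [exact: c0|rewrite d0; exact: e0].
Unshelve. all: by end_near. Qed.

Section scale_diff.
Variables (R : realType) (V W : normedModType R).

Lemma scaler_is_bilinear :
  bilinear_for
    (GRing.Scale.Law.clone _ _ *:%R _) (GRing.Scale.Law.clone _ _ *:%R _)
    (@GRing.scale R W : R^o -> W -> W).
Proof.
split=> [u'|u] a x y /=.
- by rewrite scalerDl scalerA.
- by rewrite scalerDr !scalerA mulrC.
Qed.

(** Scaling is a continuous bilinear map, and the differential of such a map
    is known; products of real functions are the case W = R^o. *)
Lemma differentiable_scale (f : V -> R^o) (g : V -> W) x :
  differentiable f x -> differentiable g x ->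
  differentiable (fun y => f y *: g y) x /\
  forall v, 'D_v (fun y => f y *: g y) x = f x *: 'D_v g x + 'D_v f x *: g x.
Proof.
move=> df dg.
pose bM := bilinear_isBilinear.Build _ _ _ _ _ _ _ scaler_is_bilinear.
pose b : {bilinear R^o -> W -> W} :=
  HB.pack (@GRing.scale R W : R^o -> W -> W) bM.
have bc : continuous (fun p : R^o * W => b p.1 p.2).
  by move=> p; exact: scale_continuous.
have dp := differentiable_pair df dg.
have db := differentiable_bilin (f x, g x) bc.
have dbp := differentiable_comp dp db.
split=> [//|v].
have E := diff_bilin (f x, g x) bc.
by rewrite (deriveE v dbp) diff_comp // /= diff_pair // E !deriveE.
Qed.

End scale_diff.

Lemma derive_comp (R : realType) (U V W : normedModType R) (f : U -> V)
    (g : V -> W) x v : differentiable f x -> differentiable g (f x) ->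
  'D_v (g \o f) x = 'D_('D_v f x) g (f x).
Proof.
move=> df dg; rewrite (deriveE _ (differentiable_comp df dg)).
rewrite (deriveE _ df) (deriveE _ dg).
exact: (congr1 (@^~ v) (diff_comp df dg)).
Qed.

Section Ck.
Variable R : realType.

Lemma Ck_on_sub (V W : normedModType R) k (O O' : set V) (f : V -> W) :
  O' `<=` O -> Ck_on k O f -> Ck_on k O' f.
Proof.
elim: k f => [|k IH] f sO /=; first by move=> cf x /sO; exact: cf.
by move=> [df Df]; split=> [x /sO/df//|v]; exact: IH.
Qed.

Lemma Ck_onS (V W : normedModType R) k (O : set V) (f : V -> W) :
  Ck_on k.+1 O f -> Ck_on k O f.
Proof.
elim: k f => [|k IH] f [df Df].
  by move=> x /df; exact: differentiable_continuous.
by split=> // v; apply: IH; exact: Df.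
Qed.

(** The conditions that Ck_on imposes at different points do not interact. *)
Lemma Ck_on_bigcup (V W : normedModType R) k (O : set V) (f : V -> W) :
  (forall x, O x -> exists2 U, U x & Ck_on k U f) -> Ck_on k O f.
Proof.
elim: k f => [|k IH] f Hf /=.
  by move=> x /Hf[U Ux cf]; exact: (cf x Ux).
split=> [x /Hf[U Ux [df _]]|v]; first exact: (df x Ux).
by apply: IH => x /Hf[U Ux [_ Df]]; exists U => //; exact: Df.
Qed.

(** The set O must be open: the derivatives at a point of O depend on the
    values of the functions at all points near it. *)
Lemma eq_Ck_on (V W : normedModType R) k (O : set V) (f g : V -> W) :
  open O -> (forall x, O x -> f x = g x) -> Ck_on k O f -> Ck_on k O g.
Proof.
move=> oO; elim: k f g => [|k IH] f g fg /=.
  move=> cf x Ox; have nO : \near x, f x = g x.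
    by apply: filterS (open_nbhs_nbhs (conj oO Ox)) => y; exact: fg.
  rewrite /prop_for /continuous_at -(fg x Ox).
  apply: (cvg_trans _ (cf x Ox)); exact: near_eq_cvg.
have nfg x (Ox : O x) : \near x, f x = g x.
  by apply: filterS (open_nbhs_nbhs (conj oO Ox)) => y; exact: fg.
move=> [df Df]; split=> [x Ox|v].
  exact: near_eq_differentiable (nfg x Ox) (df x Ox).
by apply: IH (Df v) => x Ox; exact: near_eq_derive (nfg x Ox).
Qed.

Lemma Ck_on_cst (V W : normedModType R) k (O : set V) (c : W) :
  Ck_on k O (fun _ : V => c).
Proof.
elim: k c => [|k IH] c /=; first by move=> x _; exact: cst_continuous.
split=> [x _|v]; first exact: (differentiable_cst c x).
by rewrite (_ : 'D_v _ = (fun=> 0)) //; apply/funext => x; rewrite derive_cst.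
Qed.

Lemma Ck_on_linear (V W W' : normedModType R) k (O : set V) (f : V -> W)
    (L : {linear W -> W'}) :
  open O -> continuous L -> Ck_on k O f -> Ck_on k O (L \o f).
Proof.
move=> oO cL; elim: k f => [|k IH] f /=.
  by move=> cf x Ox; apply: continuous_comp; [exact: cf|exact: cL].
have dL y : differentiable L y by apply: linear_differentiable.
move=> [df Df]; split=> [x Ox|v].
  by apply: differentiable_comp; [exact: df|exact: dL].
apply: eq_Ck_on (IH _ (Df v)) => // x Ox /=.
have dfx := df x Ox.
rewrite [RHS]deriveE; last exact: differentiable_comp.
by rewrite diff_comp //= diff_lin // deriveE.
Qed.

Lemma Ck_onD (V W : normedModType R) k (O : set V) (f g : V -> W) :
  open O -> Ck_on k O f -> Ck_on k O g -> Ck_on k O (fun x => f x + g x).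
Proof.
move=> oO; elim: k f g => [|k IH] f g /=.
  by move=> cf cg x Ox; apply: continuousD; [exact: cf|exact: cg].
move=> [df Df] [dg Dg]; split=> [x Ox|v].
  by apply: differentiableD; [exact: df|exact: dg].
apply: eq_Ck_on (IH _ _ (Df v) (Dg v)) => // x Ox.
by rewrite deriveD //; apply: diff_derivable; [exact: df|exact: dg].
Qed.

Lemma Ck_onZ (V W : normedModType R) k (O : set V) (f : V -> R^o) (g : V -> W) :
  open O -> Ck_on k O f -> Ck_on k O g -> Ck_on k O (fun x => f x *: g x).
Proof.
move=> oO; elim: k f g => [|k IH] f g.
  by move=> cf cg x Ox; apply: cvgZ; [exact: cf|exact: cg].
move=> Cf Cg; have [df Df] := Cf; have [dg Dg] := Cg; split=> [x Ox|v].
  by have [] := differentiable_scale (df x Ox) (dg x Ox).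
have H : Ck_on k O (fun x => f x *: 'D_v g x + 'D_v f x *: g x).
  apply: Ck_onD => //; apply: IH; [exact: Ck_onS|exact: Dg|exact: Df|].
  exact: Ck_onS.
apply: eq_Ck_on H => // x Ox.
by have [_ ->] := differentiable_scale (df x Ox) (dg x Ox).
Qed.

Lemma Ck_on_sum (V W : normedModType R) k (O : set V) (I : Type) (r : seq I)
    (P : pred I) (f : I -> V -> W) :
  open O -> (forall i, P i -> Ck_on k O (f i)) ->
  Ck_on k O (fun x => \sum_(i <- r | P i) f i x).
Proof.
move=> oO Hf; elim: r => [|i r IH].
  by under eq_fun do rewrite big_nil; exact: Ck_on_cst.
under eq_fun do rewrite big_cons.
by case: (boolP (P i)) => // Pi; apply: Ck_onD => //; exact: Hf.
Qed.

(** The basis e and its coordinate forms c make the finite dimension of V'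
    explicit: the chain rule
    D_v (g o f) = sum_i c_i (D_v f) *: (D_(e i) g o f)
    expresses the derivatives of the composite through sums and products of
    functions that are one order less smooth. *)
Lemma Ck_on_comp (V V' W : normedModType R) n (e : 'I_n -> V')
    (c : 'I_n -> {linear V' -> R^o}) k (O : set V) (O' : set V')
    (f : V -> V') (g : V' -> W) :
  (forall i, continuous (c i)) -> (forall v, v = \sum_i c i v *: e i) ->
  open O -> (forall x, O x -> O' (f x)) ->
  Ck_on k O f -> Ck_on k O' g -> Ck_on k O (g \o f).
Proof.
move=> cc ce oO fO; elim: k g f fO => [|k IH] g f fO.
  move=> cf cg x Ox; apply: continuous_comp; first exact: cf.
  by apply: cg; exact: fO.
move=> Cf Cg; have [df Df] := Cf; have [dg Dg] := Cg.
split=> [x Ox|v].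
  by apply: differentiable_comp; [exact: df|exact/dg/fO].
have H : Ck_on k O
    (fun x => \sum_i (c i \o 'D_v f) x *: ('D_(e i) g \o f) x).
  apply: Ck_on_sum => // i _; apply: Ck_onZ => //.
    by apply: Ck_on_linear => //; exact: Df.
  by apply: IH => //; [exact: Ck_onS|exact: Dg].
apply: eq_Ck_on H => // x Ox.
have dfx := df x Ox; have dgx := dg _ (fO x Ox).
rewrite [RHS]deriveE; last exact: differentiable_comp.
rewrite diff_comp //= -(deriveE v dfx).
rewrite [RHS](congr1 ('d g (f x)) (ce _)) linear_sum.
by apply: eq_bigr => i _; rewrite linearZ /= -deriveE.
Qed.

End Ck.

Section Ck_inv.
Variables (R : realType) (V : normedModType R).

(** Each order follows from the previous one, as the derivative of 1 / f
    along v is - (1 / f) ^ 2 * D_v f. *)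
Lemma Ck_onV k (O : set V) (f : V -> R^o) :
  open O -> (forall x, O x -> f x != 0) -> Ck_on k O f ->
  Ck_on k O (fun x => (f x)^-1 : R^o).
Proof.
move=> oO f0; elim: k => [|k IH] Cf.
  by move=> x Ox; apply: cvgV; [exact: f0|exact: Cf].
have [df Df] := Cf; split=> [x Ox|v].
  by apply: differentiableV; [exact: df|exact: f0].
have Ci := IH (Ck_onS Cf).
have H : Ck_on k O
    (fun x => (f x)^-1 *: ((f x)^-1 *: ((-1 : R^o) *: 'D_v f x))).
  apply: Ck_onZ => //; apply: Ck_onZ => //; apply: Ck_onZ => //.
    exact: Ck_on_cst.
  exact: Df.
apply: eq_Ck_on H => // x Ox.
rewrite deriveV //; [|exact: f0|by apply: diff_derivable; exact: df].
by rewrite /GRing.scale /= expr2 invfM mulN1r mulNr !mulrN mulrA.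
Qed.

End Ck_inv.

Lemma near_open (T : topologicalType) (x : T) (P : T -> Prop) :
  (\forall y \near x, P y) -> exists2 O, open_nbhs x O & forall y, O y -> P y.
Proof. by rewrite -nbhs_nearE nbhsE => -[U oU sU]; exists U. Qed.

Section smooth_at.
Variable R : realType.

(** Algebraic operations and composition preserve this local form of smooth_on
    without any bookkeeping of domains. *)
Definition smooth_at (V W : normedModType R) (f : V -> W) (x : V) : Prop :=
  exists2 U, open_nbhs x U & smooth_on U f.

Lemma smooth_onP (V W : normedModType R) (O : set V) (f : V -> W) : open O ->
  smooth_on O f <-> forall x, O x -> smooth_at f x.
Proof.
move=> oO; split=> [sf x Ox|sf k]; first by exists O.
by apply: Ck_on_bigcup => x /sf[U [_ Ux] sU]; exists U => //; exact: sU.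
Qed.

Lemma near_smooth_at (V W : normedModType R) (f : V -> W) (x : V) :
  smooth_at f x -> \near x, smooth_at f x.
Proof.
move=> [U [oU Ux] sU]; apply: filterS (open_nbhs_nbhs (conj oU Ux)) => y Uy.
by exists U.
Qed.

Lemma smooth_at_continuous (V W : normedModType R) (f : V -> W) x :
  smooth_at f x -> {for x, continuous f}.
Proof. by move=> [U [_ Ux] sU]; exact: (sU 0%N). Qed.

Lemma smooth_at_differentiable (V W : normedModType R) (f : V -> W) x :
  smooth_at f x -> differentiable f x.
Proof. by move=> [U [_ Ux] sU]; have [df _] := sU 1%N; exact: df. Qed.

Lemma smooth_at_derive (V W : normedModType R) (f : V -> W) x v :
  smooth_at f x -> smooth_at ('D_v f) x.
Proof.
by move=> [U oU sU]; exists U => // k; have [_ Df] := sU k.+1; exact: Df.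
Qed.

Lemma near_eq_smooth_at (V W : normedModType R) (f g : V -> W) x :
  (\near x, f x = g x) -> smooth_at f x -> smooth_at g x.
Proof.
move=> /near_open[ O [oO Ox] fg] [U [oU Ux] sU].

exists (O `&` U); first by split; [exact: openI|].
move=> k; apply: (@eq_Ck_on _ _ _ _ _ f); first exact: openI.
  by move=> y [/fg].
by apply: Ck_on_sub (sU k) => y [].
Qed.

Lemma smooth_at_cst (V W : normedModType R) (c : W) (x : V) :
  smooth_at (fun=> c) x.
Proof.
by exists setT => [|k]; [split => //; exact: openT|exact: Ck_on_cst].
Qed.

(** The open sets on which f and g are known to be smooth are intersected
    here, once for all binary operations. *)
Lemma smooth_at_binary (V W1 W2 W : normedModType R) (f : V -> W1) (g : V -> W2)
    (h : V -> W) x :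
  (forall k O, open O -> Ck_on k O f -> Ck_on k O g -> Ck_on k O h) ->
  smooth_at f x -> smooth_at g x -> smooth_at h x.
Proof.
move=> H [U [oU Ux] sU] [ O [oO Ox] sO].
have oUO : open (U `&` O) by exact: openI.
exists (U `&` O) => // k; apply: H => //.
- by apply: Ck_on_sub (sU k) => y [].
- by apply: Ck_on_sub (sO k) => y [].
Qed.

Lemma smooth_atD (V W : normedModType R) (f g : V -> W) x :
  smooth_at f x -> smooth_at g x -> smooth_at (fun y => f y + g y) x.
Proof. by apply: smooth_at_binary => k O; exact: Ck_onD. Qed.

Lemma smooth_atZ (V W : normedModType R) (f : V -> R^o) (g : V -> W) x :
  smooth_at f x -> smooth_at g x -> smooth_at (fun y => f y *: g y) x.
Proof. by apply: smooth_at_binary => k O; exact: Ck_onZ. Qed.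

Lemma smooth_atM (V : normedModType R) (f g : V -> R^o) x :
  smooth_at f x -> smooth_at g x -> smooth_at (fun y => f y * g y : R^o) x.
Proof. exact: smooth_atZ. Qed.

Lemma smooth_at_sum (V W : normedModType R) (I : Type) (r : seq I)
    (P : pred I) (f : I -> V -> W) x :
  (forall i, P i -> smooth_at (f i) x) ->
  smooth_at (fun y => \sum_(i <- r | P i) f i y) x.
Proof.
move=> Hf; elim: r => [|i r IH].
  by under eq_fun do rewrite big_nil; exact: smooth_at_cst.
under eq_fun do rewrite big_cons.
by case: (boolP (P i)) => // Pi; apply: smooth_atD => //; exact: Hf.
Qed.

Lemma smooth_at_prod (V : normedModType R) (I : Type) (r : seq I)
    (P : pred I) (f : I -> V -> R^o) x :
  (forall i, P i -> smooth_at (f i) x) ->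
  smooth_at (fun y => \prod_(i <- r | P i) f i y : R^o) x.
Proof.
move=> Hf; elim: r => [|i r IH].
  by under eq_fun do rewrite big_nil; exact: smooth_at_cst.
under eq_fun do rewrite big_cons.
by case: (boolP (P i)) => // Pi; apply: smooth_atM => //; exact: Hf.
Qed.

Lemma smooth_at_linear (V W W' : normedModType R) (f : V -> W)
    (L : {linear W -> W'}) x :
  continuous L -> smooth_at f x -> smooth_at (L \o f) x.
Proof.
by move=> cL [U [oU Ux] sU]; exists U => // k; exact: Ck_on_linear.
Qed.

Lemma smooth_atV (V : normedModType R) (f : V -> R^o) x :
  f x != 0 -> smooth_at f x -> smooth_at (fun y => (f y)^-1 : R^o) x.
Proof.
move=> fx0 sf; have [U [oU Ux] sU] := sf.
have : \near x, U x /\ f x != 0.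
  near=> y; split; near: y; first exact: open_nbhs_nbhs.
  have /cvgr_neq0 := smooth_at_continuous sf; exact.
move=> /near_open[ O [oO Ox] sO].
exists O => // k; apply: Ck_onV => // [y /sO[]//|].
by apply: Ck_on_sub (sU k) => y /sO[].
Unshelve. all: by end_near. Qed.

Lemma smooth_at_comp_basis (V V' W : normedModType R) n (e : 'I_n -> V')
    (c : 'I_n -> {linear V' -> R^o}) (f : V -> V') (g : V' -> W) x :
  (forall i, continuous (c i)) -> (forall v, v = \sum_i c i v *: e i) ->
  smooth_at f x -> smooth_at g (f x) -> smooth_at (g \o f) x.
Proof.
move=> cc ce sf [U' oU' sU']; have [U oU sU] := sf.
have : nbhs x (U `&` f @^-1` U').
  apply: filterI; first exact: open_nbhs_nbhs.
  by apply: (smooth_at_continuous sf); exact: open_nbhs_nbhs.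
move=> /near_open[ O [oO Ox] sO].
exists O => // k; apply: (@Ck_on_comp _ _ _ _ _ e c _ _ U') => //.
- by move=> y /sO[].
- by apply: Ck_on_sub (sU k) => y /sO[].
Qed.

Lemma smooth_at_comp n (V W : normedModType R) (f : V -> 'rV[R]_n)
    (g : 'rV[R]_n -> W) x :
  smooth_at f x -> smooth_at g (f x) -> smooth_at (g \o f) x.
Proof.
pose c0 (i : 'I_n) (v : 'rV[R]_n) : R^o := v 0 i.
have lc i : linear (c0 i) by move=> a u v; rewrite /c0 !mxE.
pose c i : {linear 'rV[R]_n -> R^o} :=
  HB.pack (c0 i) (GRing.isLinear.Build _ _ _ _ _ (lc i)).
apply: (@smooth_at_comp_basis _ _ _ n (delta_mx 0) c).
  by move=> i; exact: coord_continuous.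
by move=> v; exact: row_sum_delta.
Qed.

Lemma smooth_at_compR (V W : normedModType R) (f : V -> R^o)
    (g : R^o -> W) x :
  smooth_at f x -> smooth_at g (f x) -> smooth_at (g \o f) x.
Proof.
pose c (i : 'I_1) : {linear R^o -> R^o} := idfun.
apply: (@smooth_at_comp_basis _ _ _ 1 (fun=> 1 : R^o) c).
  by move=> i y; exact: cvg_id.
by move=> v; rewrite big_ord1 /= /GRing.scale /= mulr1.
Qed.

Lemma smooth_at_id (V : normedModType R) (x : V) : smooth_at id x.
Proof.
exists setT => [|k]; first by split => //; exact: openT.
case: k => [|k] /=; first by move=> y _.
split=> [y _ //|v].
rewrite (_ : (fun x => _) = (fun=> v)); first exact: Ck_on_cst.
by apply/funext => y; rewrite derive_id.
Qed.

Lemma smooth_at_coordP (V : normedModType R) n (f : V -> 'rV[R]_n) x :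
  smooth_at f x <-> forall j, smooth_at (fun y => f y 0 j : R^o) x.
Proof.
split=> [sf j|sf].
  apply: (smooth_at_comp (g := fun v : 'rV[R]_n => v 0 j : R^o) sf).
  pose c0 (v : 'rV[R]_n) : R^o := v 0 j.
  have lc : linear c0 by move=> a u v; rewrite /c0 !mxE.
  pose c : {linear 'rV[R]_n -> R^o} :=
    HB.pack c0 (GRing.isLinear.Build _ _ _ _ _ lc).
  apply: (smooth_at_linear (L := c) (f := id)); last exact: smooth_at_id.
  exact: coord_continuous.
have H : smooth_at (fun y => \sum_j f y 0 j *: delta_mx 0 j : 'rV[R]_n) x.
  apply: (@smooth_at_sum V 'rV[R]_n _ _ _ (fun j y => f y 0 j *: delta_mx 0 j)).
  by move=> j _; apply: smooth_atZ => //; exact: smooth_at_cst.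
by apply: near_eq_smooth_at H; near=> y; rewrite -row_sum_delta.
Unshelve. all: by end_near. Qed.

End smooth_at.

(** * A smooth function with compact support *)

Section flat.
Variable R : realType.

(** The factors x^-j turn exp (- 1 / x) into a family that is closed under
    differentiation up to linear combinations. *)
Definition flat (j : nat) (x : R) : R :=
  if 0 < x then (x^-1) ^+ j * expR (- x^-1) else 0.

Lemma flat_ge0 j x : 0 <= flat j x.
Proof.
rewrite /flat; case: ifP => // x0.
by rewrite mulr_ge0 ?expR_ge0 // exprn_ge0 // invr_ge0 ltW.
Qed.

(** At y = 1 / x the exponential exp y exceeds its Taylor term of degree
    j + 1. *)
Lemma flat_le (j : nat) (x : R) : 0 < x -> flat j x <= (j.+1)`!%:R * x.
Proof.
move=> x0; rewrite /flat x0 expRN ler_pdivrMr ?expR_gt0//.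
have y0 : 0 <= x^-1 by rewrite invr_ge0 ltW.
have f0 : 0 < (j.+1)`!%:R :> R by rewrite ltr0n fact_gt0.
have : x^-1 ^+ j.+1 <= (j.+1)`!%:R * expR x^-1.
  rewrite mulrC -ler_pdivrMr //.
  by apply: le_trans (expR_ge1Dxn j y0); rewrite lerDr ler01.
by rewrite exprS ler_pdivrMl // mulrCA mulrA.
Qed.

(** At 0 the difference quotient of flat j is flat j.+1 on the right and 0
    on the left; both tend to 0 by flat_le. *)
Lemma is_derive_flat (j : nat) (x : R) :
  is_derive x 1 (flat j : R^o -> R^o) (flat j.+2 x - j%:R * flat j.+1 x).
Proof.
have [x0|x0|->] := ltgtP x 0.
- apply: (@near_eq_is_derive _ R^o R^o (cst 0)); last first.
    by rewrite /flat ltNge (ltW x0) /= mulr0 subrr; exact: is_derive_cst.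
  near=> y; rewrite /flat ifF //; apply/negbTE; rewrite -leNgt ltW //.
  by near: y; exact: lt_nbhsl.
- apply: (@near_eq_is_derive _ R^o R^o
    (fun y => y^-1 ^+ j * expR (- y^-1))).
    near=> y; rewrite /flat ifT //.
    by near: y; exact: lt_nbhsr.
  have xn0 : x != 0 by rewrite gt_eqF.
  have dV : is_derive x 1 (fun y : R^o => y^-1 : R^o) (- x ^- 2).
    apply: DeriveDef; first exact: derivableV.
    have di : derivable (id : R^o -> R^o) x 1 by exact: derivable_id.
    rewrite (deriveV xn0 di).
    by rewrite derive_id /GRing.scale /= mulr1.
  have dE : is_derive x 1 (fun y : R^o => expR (- y^-1) : R^o)
      (x ^- 2 * expR (- x^-1)).
    have dN : is_derive x 1 (fun y : R^o => - y^-1 : R^o) (x ^- 2).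
      by have := is_deriveN dV; rewrite opprK.
    have := @is_derive1_comp R expR (fun y => - y^-1) x _ _
      (is_derive_expR (- x^-1)) dN.
    by rewrite mulrC.
  have dX := is_deriveX j dV.
  have := is_deriveM dX dE.
  rewrite exprfctE mulrfctE /flat x0 => H; apply: (is_derive_eq H).
  rewrite /GRing.scale /= -!exprVn.
  case: j {dX H} => [|j] /=.
    by rewrite !mulr0n !mul0r !mulr0 subr0 addr0 expr0 mul1r.
  rewrite -[_ *+ j.+1]mulr_natl !exprS; ring.
- have -> : flat j.+2 0 - j%:R * flat j.+1 0 = 0 :> R.
    by rewrite /flat ltxx mulr0 subrr.
  suff H : (fun h => h^-1 *: ((flat j \o shift 0) (h *: 1) - flat j 0))
      @ (0 : R)^' --> (0 : R^o).
    by apply: DeriveDef; [apply: cvgP H|exact: cvg_lim H].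
  apply/cvgr0Pnorm_le => e e0.
  near=> h.
  rewrite /= addr0 [h%:A]mulr1 [flat j 0]/flat ltxx subr0.
  have h0 : h != 0 by near: h; exact: nbhs_dnbhs_neq.
  have [hp|hn] := ltP 0 h; last by rewrite /flat ltNge hn /= scaler0 normr0 ltW.
  have -> : h^-1 *: flat j h = flat j.+1 h.
    by rewrite /flat hp exprS /GRing.scale /= mulrA.
  rewrite ger0_norm ?flat_ge0 // (le_trans (flat_le _ hp)) //.
  have f0 : 0 < (j.+2)`!%:R :> R by rewrite ltr0n fact_gt0.
  rewrite mulrC -ler_pdivlMr // (le_trans (ler_norm _)) //.
  near: h; apply: dnbhs0_le; exact: divr_gt0.
Unshelve. all: by end_near. Qed.

Lemma smooth_flat j x : smooth_at (flat j : R^o -> R^o) x.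
Proof.
exists setT => [|k]; first by split => //; exact: openT.
elim: k j {x} => [|k IH] j.
  move=> x _; apply/differentiable_continuous/derivable1_diffP.
  by have [] := is_derive_flat j x.
split=> [x _|v].
  by apply/derivable1_diffP; have [] := is_derive_flat j x.
have H : Ck_on k setT
    (fun x : R^o => (v : R^o) *:
      (flat j.+2 x + (- j%:R : R^o) *: flat j.+1 x : R^o)).
  apply: Ck_onZ; [exact: openT|exact: Ck_on_cst|].
  apply: Ck_onD; [exact: openT|exact: IH|].
  by apply: Ck_onZ; [exact: openT|exact: Ck_on_cst|exact: IH].
apply: eq_Ck_on H => [|x _]; first exact: openT.
have [dx vx] := is_derive_flat j x.
have df : differentiable (flat j : R^o -> R^o) x by apply/derivable1_diffP.
rewrite deriveE // -[v in RHS]mulr1 [in RHS](linearZ_LR _ v (1 : R^o)).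
rewrite -deriveE // vx.
by rewrite /GRing.scale /= mulNr.
Qed.

Lemma flat_gt0 j x : (0 < flat j x) = (0 < x).
Proof.
rewrite /flat; case: ifP => x0; last by rewrite ltxx.
by rewrite mulr_gt0 ?expR_gt0 // exprn_gt0 // invr_gt0.
Qed.

End flat.

(** A factor is positive exactly when the i-th coordinates of y and c are less
    than r apart. *)
Definition cube_bump (R : realType) n (c : 'rV[R]_n) (r : R)
    (y : 'rV[R]_n) : R^o :=
  \prod_i (flat 0 (r ^+ 2 - (y 0 i - c 0 i) ^+ 2) : R^o).

Lemma smooth_cube_bump (R : realType) n (c : 'rV[R]_n) (r : R) y :
  smooth_at (cube_bump c r) y.
Proof.
have sid := smooth_at_id y.
pose f (i : 'I_n) (y : 'rV[R]_n) : R^o :=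
  flat 0 (r ^+ 2 - (y 0 i - c 0 i) ^+ 2).
suff H i : smooth_at (f i) y.
  apply: (@smooth_at_prod R _ _ (index_enum 'I_n) xpredT f) => i _; exact: H.
rewrite /f.
have sq : smooth_at (fun y : 'rV[R]_n => y 0 i + (- c 0 i) : R^o) y.
  apply: smooth_atD; last exact: smooth_at_cst.
  by have /smooth_at_coordP := sid; exact.
apply: (@smooth_at_compR R _ _
  (fun y : 'rV[R]_n => r ^+ 2 - (y 0 i - c 0 i) ^+ 2)); last exact: smooth_flat.
have H : smooth_at (fun y : 'rV[R]_n => (r ^+ 2 : R^o) +
    (-1 : R^o) *: ((y 0 i + (- c 0 i) : R^o) * (y 0 i + (- c 0 i)) : R^o)) y.
  apply: smooth_atD; first exact: smooth_at_cst.
  by apply: smooth_atZ; [exact: smooth_at_cst|exact: smooth_atM].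
by apply: near_eq_smooth_at H; near=> z; rewrite scaleN1r expr2.
Unshelve. all: by end_near. Qed.

Lemma cube_bump_gt0 (R : realType) n (c : 'rV[R]_n) (r : R) :
  0 < r -> 0 < cube_bump c r c.
Proof.
move=> r0; apply: prodr_gt0 => i _.
by rewrite flat_gt0 subrr expr0n subr0 exprn_gt0.
Qed.

Lemma cube_bump_neq0 (R : realType) n (c : 'rV[R]_n) (r : R) y :
  0 < r -> cube_bump c r y != 0 -> `|y - c| <= r.
Proof.
move=> r0 /prodf_neq0 H.
rewrite /Num.Def.normr /= mx_normrE; apply: bigmax_le; first exact: ltW.
move=> [i j] _ /=; rewrite (ord1 i) !mxE.
have : 0 < flat 0 (r ^+ 2 - (y 0 j - c 0 j) ^+ 2).
  by rewrite lt_def flat_ge0 (H j isT).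
rewrite flat_gt0 subr_gt0 -ltr_sqrt ?exprn_gt0 // !sqrtr_sqr.
rewrite [X in _ < X]gtr0_norm // => H'.
exact: ltW H'.
Qed.

(** * Tangent vectors and smoothness in charts *)

Section charts.
Variables (R : realType) (d : nat) (M : manifold R d).

Lemma near_chart_inv (a p : M) (P : M -> Prop) : dom a p ->
  (\forall q \near p, P q) -> \forall y \near chart a p, P (chart_inv a y).
Proof.
move=> ap nP; have := chart_inv_continuous ap; apply.
by rewrite /= (chartK ap).
Qed.

Lemma near_chart (a p : M) (P : 'rV[R]_d -> Prop) : dom a p ->
  (\forall y \near chart a p, P y) -> \forall q \near p, P (chart a q).
Proof. by move=> ap nP; exact: (chart_continuous ap). Qed.

Lemma near_dom (a p : M) : dom a p -> \forall q \near p, dom a q.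
Proof. by move=> ap; apply: open_nbhs_nbhs; split => //; exact: dom_open. Qed.

Lemma near_chart_invK (a p : M) : dom a p ->
  \forall y \near chart a p, chart a (chart_inv a y) = y.
Proof.
move=> ap; have : \forall y \near chart a p, (chart a @` dom a) y.
  by apply: open_nbhs_nbhs; split; [exact: chart_open|exists p].
by apply: filterS => _ [q aq <-]; rewrite (chartK aq).
Qed.

Lemma open_chart_image (a : M) (O : set M) : open O -> O `<=` dom a ->
  open (chart a @` O).
Proof.
move=> oO sO; rewrite openE => _ [p Op <-].
have ap := sO _ Op.
have nO := near_chart_inv ap (open_nbhs_nbhs (conj oO Op)).
rewrite /interior; apply: filterS2 nO (near_chart_invK ap) => y Oy <-.
by exists (chart_inv a y).
Qed.

Lemma smooth_transition (a b p : M) : dom a p -> dom b p ->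
  smooth_at (chart b \o chart_inv a) (chart a p).
Proof.
move=> ap bp; have := chart_compatible a b.
have oab : open (chart a @` (dom a `&` dom b)).
  apply: open_chart_image; first by apply: openI; exact: dom_open.
  by move=> q [].
by move/(smooth_onP _ oab); apply; exists p.
Qed.

(** The preferred chart at p only serves as a reference: by smooth_nearE
    every chart around p defines the same notion. *)
Definition smooth_near (W : normedModType R) (h : M -> W) (p : M) : Prop :=
  smooth_at (h \o chart_inv p) (chart p p).

Lemma smooth_at_chart (W : normedModType R) (h : M -> W) (a b p : M) :
  dom a p -> dom b p ->
  smooth_at (h \o chart_inv a) (chart a p) ->
  smooth_at (h \o chart_inv b) (chart b p).
Proof.
move=> ap bp sh.
have sg : smooth_at (h \o chart_inv a) ((chart a \o chart_inv b) (chart b p)).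
  by rewrite /= (chartK bp).
have H := smooth_at_comp (smooth_transition bp ap) sg.
apply: near_eq_smooth_at H.
have := near_chart_inv bp (near_dom ap).
by apply: filterS => y ay /=; rewrite (chartK ay).
Qed.

Lemma smooth_nearE (W : normedModType R) (h : M -> W) (a p : M) : dom a p ->
  smooth_near h p <-> smooth_at (h \o chart_inv a) (chart a p).
Proof.
by move=> ap; split; apply: smooth_at_chart => //; exact: dom_center.
Qed.

Lemma near_eq_smooth_near (W : normedModType R) (f g : M -> W) (p : M) :
  (\forall q \near p, f q = g q) -> smooth_near f p -> smooth_near g p.
Proof.
by move=> fg; apply: near_eq_smooth_at; exact: near_chart_inv (dom_center p) fg.
Qed.

Lemma near_smooth_near (W : normedModType R) (f : M -> W) (p : M) :
  smooth_near f p -> \forall q \near p, smooth_near f q.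
Proof.
move=> /near_smooth_at/(near_chart (dom_center p)).
by apply: filterS2 (near_dom (dom_center p)) => q pq; rewrite -smooth_nearE.
Qed.

Lemma smooth_near_comp n (W : normedModType R) (f : M -> 'rV[R]_n)
    (g : 'rV[R]_n -> W) p :
  smooth_near f p -> smooth_at g (f p) -> smooth_near (g \o f) p.
Proof.
move=> sf sg; apply: (smooth_at_comp sf).
by rewrite /= (chartK (dom_center p)).
Qed.

Lemma smooth_near_chart (b p : M) : dom b p -> smooth_near (chart b) p.
Proof. by move=> bp; exact: smooth_transition (dom_center p) bp. Qed.

Lemma smooth_funP (f : M -> R) :
  smooth_fun f <-> forall p, smooth_near (f : M -> R^o) p.
Proof.
split=> [sf p|sf a].
  have := sf p; move/(smooth_onP _ (chart_open (a:=p))); apply.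
  by exists p => //; exact: dom_center.
apply/(smooth_onP _ (chart_open (a:=a))) => _ [p ap <-].
by apply/smooth_nearE.
Qed.

Lemma dirder_linear (W : normedModType R) (h : M -> W) p : smooth_near h p ->
  linear (fun v => dirder p v h).
Proof.
move=> /smooth_at_differentiable dh c u v.
by rewrite /dirder !deriveE // linearP.
Qed.

Lemma dirder0 (W : normedModType R) (h : M -> W) p : dirder p 0 h = 0.
Proof. exact: derive0. Qed.

Lemma dirderZ (W : normedModType R) (h : M -> W) p c v : smooth_near h p ->
  dirder p (c *: v) h = c *: dirder p v h.
Proof.
move=> sh; have := dirder_linear sh c v 0.
by rewrite dirder0 !addr0.
Qed.

Lemma dirderD (W : normedModType R) (h : M -> W) p u v : smooth_near h p ->
  dirder p (u + v) h = dirder p u h + dirder p v h.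
Proof.
by move=> sh; have := dirder_linear sh 1 u v; rewrite !scale1r.
Qed.

Lemma dirderB (W : normedModType R) (h : M -> W) p u v : smooth_near h p ->
  dirder p (u - v) h = dirder p u h - dirder p v h.
Proof. by move=> sh; rewrite -scaleN1r dirderD // dirderZ // scaleN1r. Qed.

Lemma dirder_sum (W : normedModType R) (h : M -> W) p (I : Type) (r : seq I)
    (P : pred I) (v : I -> 'rV[R]_d) : smooth_near h p ->
  dirder p (\sum_(i <- r | P i) v i) h = \sum_(i <- r | P i) dirder p (v i) h.
Proof.
move=> sh; elim: r => [|i r IH]; first by rewrite !big_nil dirder0.
by rewrite !big_cons; case: ifP => // _; rewrite dirderD // IH.
Qed.

Lemma near_eq_dirder (W : normedModType R) (f g : M -> W) p v :
  (\forall q \near p, f q = g q) -> dirder p v f = dirder p v g.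
Proof.
by move=> fg; apply: near_eq_derive; exact: near_chart_inv (dom_center p) fg.
Qed.

(** A tangent vector v at p is stored through its components in chart p.  Its
    components in another chart b are dirder p v (chart b), by the chain rule
    for the change of charts. *)
Lemma dirder_in_chart (W : normedModType R) (h : M -> W) (b p : M) v :
  dom b p -> smooth_near h p ->
  dirder p v h = 'D_(dirder p v (chart b)) (h \o chart_inv b) (chart b p).
Proof.
move=> bp sh; have pp := dom_center p.
have dh : differentiable (h \o chart_inv b)
    ((chart b \o chart_inv p) (chart p p)).
  rewrite /= (chartK pp); apply: smooth_at_differentiable.
  exact/smooth_nearE.
have dt := smooth_at_differentiable (smooth_transition pp bp).
rewrite /dirder; have := derive_comp v dt dh; rewrite /= (chartK pp) => <-.
apply: near_eq_derive; have := near_chart_inv pp (near_dom bp).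
by apply: filterS => y by_ /=; rewrite (chartK by_).
Qed.

Lemma dirder_self (p : M) v : dirder p v (chart p) = v :> 'rV[R]_d.
Proof.
transitivity ('D_v (@idfun 'rV[R]_d) (@chart R d M p p)); last exact: derive_id.
by apply: near_eq_derive; exact: near_chart_invK (dom_center p).
Qed.

(** The tangent vector at p whose components in the chart b are c: see
    dirderK and vec_ofK. *)
Definition vec_of (b p : M) (c : 'rV[R]_d) : 'rV[R]_d :=
  'D_c (chart p \o chart_inv b) (chart b p).

Lemma vec_of_linear b p : dom b p -> linear (vec_of b p).
Proof.
move=> bp c u v; rewrite /vec_of.
have dt := smooth_at_differentiable (smooth_transition bp (dom_center p)).
by rewrite !deriveE // linearP.
Qed.

Lemma dirderK b p v : dom b p -> vec_of b p (dirder p v (chart b)) = v.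
Proof.
move=> bp; rewrite /vec_of -dirder_in_chart ?dirder_self //.
exact/smooth_near_chart/dom_center.
Qed.

Lemma vec_ofK b p c : dom b p -> dirder p (vec_of b p c) (chart b) = c.
Proof.
move=> bp; have pp := dom_center p.
have dt := smooth_at_differentiable (smooth_transition bp pp).
have ds : differentiable (chart b \o chart_inv p)
    ((chart p \o chart_inv b) (chart b p)).
  rewrite /= (chartK bp).
  exact: smooth_at_differentiable (smooth_transition pp bp).
transitivity ('D_c (@idfun 'rV[R]_d) (@chart R d M b p)); last exact: derive_id.
rewrite /dirder /vec_of.
have := derive_comp c dt ds; rewrite /= (chartK bp) => <-.
apply: near_eq_derive; have := near_chart_inv bp (near_dom pp).
by apply: filterS2 (near_chart_invK bp) => y /= e py; rewrite (chartK py).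
Qed.

Lemma smooth_map_id : smooth_map (idfun : M -> M).
Proof.
by split=> [p|a b]; [exact: cvg_id|exact: chart_compatible].
Qed.

End charts.

Section maps.
Variables (R : realType) (d n : nat) (M : manifold R d) (N : manifold R n).
Variables (F : M -> N) (sF : smooth_map F).

Let cF : continuous F. Proof. by case: sF. Qed.

Let oF (a : M) (b : N) : open (dom a `&` F @^-1` dom b).
Proof.
apply: openI; first exact: dom_open.
apply: open_comp; last exact: dom_open.
by move=> p _; exact: cF.
Qed.

Let oCF (a : M) (b : N) : open (chart a @` (dom a `&` F @^-1` dom b)).
Proof. by apply: open_chart_image => // p []. Qed.

Lemma near_map_dom (b : N) p : dom b (F p) -> \forall q \near p, dom b (F q).
Proof. by move=> bp; apply: cF; exact: near_dom. Qed.

Lemma smooth_map_chart (b : N) p : dom b (F p) -> smooth_near (chart b \o F) p.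
Proof.
move=> bp; have [_ H] := sF; have := H p b.
move/(smooth_onP _ (@oCF p b)); apply.
by exists p => //; split => //; exact: dom_center.
Qed.

Lemma smooth_alongP (s : M -> 'rV[R]_n) :
  smooth_along F s <-> forall p (b : N), dom b (F p) ->
    smooth_near (fun q => dirder (F q) (s q) (chart b)) p.
Proof.
split=> [ss p b bp|ss a b].
  have := ss p b; move/(smooth_onP _ (@oCF p b)); apply.
  by exists p => //; split => //; exact: dom_center.
apply/(smooth_onP _ (@oCF a b)) => _ [p [ap bp] <-].
by have /(smooth_nearE _ ap) := ss p b bp.
Qed.

Lemma smooth_near_map (W : normedModType R) (h : N -> W) p :
  smooth_near h (F p) -> smooth_near (h \o F) p.
Proof.
move=> sh; have b0 := dom_center (F p).
have H := smooth_near_comp (smooth_map_chart b0) sh.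
apply: near_eq_smooth_near H; have := near_map_dom b0.
by apply: filterS => q bq /=; rewrite (chartK bq).
Qed.

Lemma smooth_fun_map (f : N -> R) : smooth_fun f -> smooth_fun (f \o F).
Proof.
by move=> /smooth_funP sf; apply/smooth_funP => p; exact: smooth_near_map.
Qed.

(** The chain rule for h o F, read in the preferred charts at p and F p. *)
Lemma dirder_push (W : normedModType R) (h : N -> W) p v :
  smooth_near h (F p) -> dirder p v (h \o F) = dirder (F p) (push F p v) h.
Proof.
move=> sh; have b0 := dom_center (F p); have pp := dom_center p.
have dc := smooth_at_differentiable (smooth_map_chart b0).
have dh : differentiable (h \o chart_inv (F p))
    ((chart (F p) \o F \o chart_inv p) (chart p p)).
  by rewrite /= (chartK pp); exact: smooth_at_differentiable.
transitivity (dirder p v ((h \o chart_inv (F p)) \o (chart (F p) \o F))).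
  apply: near_eq_dirder; have := near_map_dom b0.
  by apply: filterS => q bq /=; rewrite (chartK bq).
rewrite /push /dirder.
by have := derive_comp v dc dh; rewrite /= (chartK pp); exact.
Qed.

(** In the chart b the derivative is a sum of products of components of s and
    partial derivatives of h.  For h another chart, this shows that the
    components of s need only be smooth in one chart around each point. *)
Lemma smooth_near_dirder (W : normedModType R) (s : M -> 'rV[R]_n) (b : N)
    (h : N -> W) p :
  dom b (F p) -> smooth_near (fun q => dirder (F q) (s q) (chart b)) p ->
  smooth_near h (F p) -> smooth_near (fun q => dirder (F q) (s q) h) p.
Proof.
move=> bp ss sh.
have H : smooth_near (fun q =>
    \sum_j (dirder (F q) (s q) (chart b) 0 j : R^o) *:
    ('D_(delta_mx 0 j) (h \o chart_inv b) \o (chart b \o F)) q) p.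
  apply: (@smooth_at_sum R _ W) => j _; apply: smooth_atZ.
    by have /smooth_at_coordP := ss; exact.
  apply: smooth_near_comp; first exact: smooth_map_chart.
  by apply: smooth_at_derive; exact/smooth_nearE.
apply: near_eq_smooth_near H.
have nh : \forall q \near p, smooth_near h (F q).
  by apply: cF; exact: near_smooth_near.
apply: filterS2 (near_map_dom bp) nh => q bq shq.
rewrite (dirder_in_chart _ bq shq).
have dh : differentiable (h \o chart_inv b) (chart b (F q)).
  by apply: smooth_at_differentiable; exact/smooth_nearE.
rewrite [RHS]deriveE // [in RHS](row_sum_delta (dirder _ _ _)) linear_sum.
by apply: eq_bigr => j _; rewrite linearZ /= deriveE.
Qed.

Lemma smooth_along_chart (s : M -> 'rV[R]_n) :
  (forall p, exists2 b : N, dom b (F p) &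
    smooth_near (fun q => dirder (F q) (s q) (chart b)) p) ->
  smooth_along F s.
Proof.
move=> H; apply/smooth_alongP => p b bp; have [b' b'p sb'] := H p.
by apply: smooth_near_dirder b'p sb' _; exact: smooth_near_chart.
Qed.

Lemma smooth_along_dirder (W : normedModType R) (s : M -> 'rV[R]_n)
    (h : N -> W) p :
  smooth_along F s -> smooth_near h (F p) ->
  smooth_near (fun q => dirder (F q) (s q) h) p.
Proof.
move=> /smooth_alongP ss sh; have b0 := dom_center (F p).
exact: smooth_near_dirder b0 (ss _ _ b0) sh.
Qed.

End maps.

(** * Smooth functions, smooth sections and bump functions *)

Section smooth_functions.
Variables (R : realType) (d : nat) (M : manifold R d).

Lemma smooth_fun_cst (c : R) : smooth_fun (fun=> c : R) (M := M).
Proof. by apply/smooth_funP => p; exact: smooth_at_cst. Qed.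

Lemma smooth_funD (f g : M -> R) :
  smooth_fun f -> smooth_fun g -> smooth_fun (fun q => f q + g q).
Proof.
move=> /smooth_funP sf /smooth_funP sg; apply/smooth_funP => p.
exact: (smooth_atD (sf p) (sg p)).
Qed.

Lemma smooth_funM (f g : M -> R) :
  smooth_fun f -> smooth_fun g -> smooth_fun (fun q => f q * g q).
Proof.
move=> /smooth_funP sf /smooth_funP sg; apply/smooth_funP => p.
exact: (smooth_atM (sf p) (sg p)).
Qed.

Lemma smooth_fun_sum (I : Type) (r : seq I) (P : pred I) (f : I -> M -> R) :
  (forall i, P i -> smooth_fun (f i)) ->
  smooth_fun (fun q => \sum_(i <- r | P i) f i q).
Proof.
move=> sf; elim: r => [|i r IH].
  by under eq_fun do rewrite big_nil; exact: smooth_fun_cst.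
under eq_fun do rewrite big_cons.
by case: (boolP (P i)) => // Pi; apply: smooth_funD => //; exact: sf.
Qed.

Lemma smooth_fun_prod (I : Type) (r : seq I) (P : pred I) (f : I -> M -> R) :
  (forall i, P i -> smooth_fun (f i)) ->
  smooth_fun (fun q => \prod_(i <- r | P i) f i q).
Proof.
move=> sf; elim: r => [|i r IH].
  by under eq_fun do rewrite big_nil; exact: smooth_fun_cst.
under eq_fun do rewrite big_cons.
by case: (boolP (P i)) => // Pi; apply: smooth_funM => //; exact: sf.
Qed.

Lemma smooth_fun_det k (A : M -> 'M[R]_k) :
  (forall i j, smooth_fun (fun q => A q i j)) ->
  smooth_fun (fun q => \det (A q)).
Proof.
move=> sA; rewrite /determinant; apply: smooth_fun_sum => s _.
by apply: smooth_funM; [exact: smooth_fun_cst|exact: smooth_fun_prod].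
Qed.

(** With smooth_fun_det, this makes the solution of a linear system with
    smooth coefficients smooth, by Cramer's rule. *)
Lemma smooth_fun_adj k (A : M -> 'M[R]_k) :
  (forall i j, smooth_fun (fun q => A q i j)) ->
  forall i j, smooth_fun (fun q => (\adj (A q)) i j).
Proof.
move=> sA i j; under eq_fun do rewrite mxE /cofactor.
apply: smooth_funM; first exact: smooth_fun_cst.
by apply: smooth_fun_det => a b; under eq_fun do rewrite !mxE; exact: sA.
Qed.

Lemma smooth_fun_mulmx k l m (A : M -> 'M[R]_(k, l)) (B : M -> 'M[R]_(l, m)) :
  (forall i j, smooth_fun (fun q => A q i j)) ->
  (forall i j, smooth_fun (fun q => B q i j)) ->
  forall i j, smooth_fun (fun q => (A q *m B q) i j).
Proof.
move=> sA sB i j; under eq_fun do rewrite mxE.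
by apply: smooth_fun_sum => a _; exact: smooth_funM.
Qed.

Lemma near_smooth_fun_neq0 (f : M -> R) p :
  smooth_fun f -> f p != 0 -> \forall q \near p, f q != 0.
Proof.
move=> /smooth_funP/(_ p)/smooth_at_continuous cf fp; have pp := dom_center p.
have : \forall y \near chart p p, (f \o chart_inv p) y != 0.
  by move/cvgr_neq0: cf; apply; rewrite /= (chartK pp).
move=> /(near_chart pp); apply: filterS2 (near_dom pp) => q pq /=.
by rewrite (chartK pq).
Qed.

(** Functions given implicitly, as solutions f of e * f = u with e invertible,
    are smooth; e and u may depend on the point under consideration. *)
Lemma smooth_fun_div (f : M -> R) :
  (forall p, exists e u : M -> R, [/\ smooth_fun e, smooth_fun u, e p != 0 &
    \forall q \near p, e q * f q = u q]) ->
  smooth_fun f.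
Proof.
move=> H; apply/smooth_funP => p.
have [e [u [se0 /smooth_funP su ep eq]]] := H p.
have se := (smooth_funP e).1 se0.
have eq0 := near_smooth_fun_neq0 se0 ep.
have si : smooth_at (fun y => ((e \o chart_inv p) y)^-1 : R^o) (chart p p).
  by apply: smooth_atV (se p); rewrite /= (chartK (dom_center p)).
have := smooth_atM si (su p).
apply: (@near_eq_smooth_near R d M R^o (fun q => (e q)^-1 * u q)).
by apply: filterS2 eq eq0 => q <- e0; rewrite mulrA mulVf // mul1r.
Qed.

Lemma lieD X (f g : M -> R) p : smooth_fun f -> smooth_fun g ->
  lie X (fun q => f q + g q) p = lie X f p + lie X g p.
Proof.
move=> /smooth_funP/(_ p)/smooth_at_differentiable df.
move=> /smooth_funP/(_ p)/smooth_at_differentiable dg.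
rewrite /lie /dirder.
by apply: (@deriveD _ _ _ (f \o chart_inv p) (g \o chart_inv p));
  exact: diff_derivable.
Qed.

Lemma lieM X (f g : M -> R) p : smooth_fun f -> smooth_fun g ->
  lie X (fun q => f q * g q) p = lie X f p * g p + f p * lie X g p.
Proof.
move=> /smooth_funP/(_ p)/smooth_at_differentiable df.
move=> /smooth_funP/(_ p)/smooth_at_differentiable dg.
have [_ /(_ (X p)) H] := differentiable_scale df dg.
move: H; rewrite /lie /dirder /= (chartK (dom_center p)) => H.
by rewrite [RHS]addrC; exact: H.
Qed.

Lemma lie_cst X (c : R) (p : M) : lie X (fun=> c : R) p = 0 :> R.
Proof. exact: derive_cst. Qed.

End smooth_functions.

Section smooth_sections.
Variables (R : realType) (d n : nat) (M : manifold R d) (N : manifold R n).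
Variables (F : M -> N) (sF : smooth_map F).
Implicit Types s t : M -> 'rV[R]_n.

Lemma smooth_alongD s t : smooth_along F s -> smooth_along F t ->
  smooth_along F (fun q => s q + t q).
Proof.
move=> /(smooth_alongP sF) ss /(smooth_alongP sF) st.
apply/(smooth_alongP sF) => p b bp.
apply: near_eq_smooth_near (smooth_atD (ss p b bp) (st p b bp)).
apply: filterS (near_map_dom sF bp) => q bq /=.
by rewrite dirderD //; exact: smooth_near_chart.
Qed.

Lemma smooth_along0 : smooth_along F (fun=> 0).
Proof.
apply/(smooth_alongP sF) => p b bp.
apply: near_eq_smooth_near (smooth_at_cst 0 _).
by apply: filterE => q; rewrite dirder0.
Qed.

Lemma smooth_alongZ (f : M -> R) s : smooth_fun f -> smooth_along F s ->
  smooth_along F (fun q => f q *: s q).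
Proof.
move=> /smooth_funP sf /(smooth_alongP sF) ss.
apply/(smooth_alongP sF) => p b bp.
apply: near_eq_smooth_near (smooth_atZ (sf p) (ss p b bp)).
apply: filterS (near_map_dom sF bp) => q bq /=.
by rewrite dirderZ //; exact: smooth_near_chart.
Qed.

Lemma smooth_along_sum (I : Type) (r : seq I) (P : pred I)
    (s : I -> M -> 'rV[R]_n) :
  (forall i, P i -> smooth_along F (s i)) ->
  smooth_along F (fun q => \sum_(i <- r | P i) s i q).
Proof.
move=> ss; elim: r => [|i r IH].
  by under eq_fun do rewrite big_nil; exact: smooth_along0.
under eq_fun do rewrite big_cons.
case: (boolP (P i)) => Pi; last exact: IH.
exact: (smooth_alongD (ss i Pi) IH).
Qed.

Lemma smooth_along_comp (Z : N -> 'rV[R]_n) :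
  smooth_field Z -> smooth_along F (Z \o F).
Proof.
move=> /(smooth_alongP (@smooth_map_id R n N)) sZ.
apply/(smooth_alongP sF) => p b bp.
exact: (smooth_near_map sF (sZ (F p) b bp)).
Qed.

(** The analogue of smooth_fun_div for sections. *)
Lemma smooth_along_div s :
  (forall p, exists (e : M -> R) u, [/\ smooth_fun e, smooth_along F u,
    e p != 0 & \forall q \near p, e q *: s q = u q]) ->
  smooth_along F s.
Proof.
move=> H; apply/(smooth_alongP sF) => p b bp.
have [e [u [se0 /(smooth_alongP sF) su ep eq]]] := H p.
have se := (smooth_funP e).1 se0.
have eq0 := near_smooth_fun_neq0 se0 ep.
have si : smooth_at (fun y => ((e \o chart_inv p) y)^-1 : R^o) (chart p p).
  by apply: smooth_atV (se p); rewrite /= (chartK (dom_center p)).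
have := smooth_atZ si (su p b bp).
apply: (@near_eq_smooth_near R d M _
  (fun q => (e q)^-1 *: dirder (F q) (u q) (chart b))).
apply: filterS2 (near_map_dom sF bp) (filterI eq eq0) => q bq /= [<- e0].
by rewrite dirderZ ?scalerA ?mulVf ?scale1r //; exact: smooth_near_chart.
Qed.

End smooth_sections.

Section bump.
Variables (R : realType) (d : nat) (M : manifold R d).

(** The open set O is the complement of the image of a closed cube, which is
    compact, hence closed because the manifold is Hausdorff.  As O and the
    domain of the chart cover the manifold, a function cut off by psi can be
    proved smooth separately on each of them. *)
Lemma manifold_bump (q0 : M) : exists (psi : M -> R) (O : set M),
  [/\ smooth_fun psi, psi q0 = 1, open O, forall q, ~ dom q0 q -> O q &
      forall q, O q -> psi q = 0].
Proof.
have q00 := dom_center q0; set c := chart q0 q0.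
have : nbhs c (chart q0 @` dom q0).
  by apply: open_nbhs_nbhs; split; [exact: chart_open|exists q0].
move=> /nbhs_ballP[e /= e0 be].
pose r := e / 2; have r0 : 0 < r by rewrite divr_gt0.
pose A : set 'rV[R]_d := [set y | `|y - c| <= r].
have sA y : A y -> (chart q0 @` dom q0) y.
  move=> Ay; apply: be; rewrite -ball_normE /= distrC.
  by apply: le_lt_trans Ay _; rewrite /r ltr_pdivrMr // ltr_pMr // ltr1n.
have cA : compact A.
  apply: bounded_closed_compact.
    exists (r + `|c|); split; first by rewrite num_real.
    move=> x xr y Ay; apply: le_trans (ltW xr).
    by rewrite -[y](subrK c) (le_trans (ler_normD _ _)) // lerD2r.
  rewrite (_ : A = (fun y => `|y - c|) @^-1` [set x | x <= r]) //.
  apply: (@closed_comp _ _ (fun y : 'rV[R]_d => `|y - c|) [set x | x <= r]);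
    last exact: closed_le.
  move=> y _; apply: continuous_comp; last exact: norm_continuous.
  apply: (@continuousB _ _ _ id (cst c)); first exact: cvg_id.
  exact: cst_continuous.
have cK : compact (chart_inv q0 @` A).
  apply: continuous_compact => //; apply: continuous_in_subspaceT => y.
  by rewrite inE => /sA[q qd <-]; exact: chart_inv_continuous.
have clK : closed (chart_inv q0 @` A).
  by apply: compact_closed => //; exact: hausdorff_manifold.
pose psi0 q := cube_bump c r (chart q0 q) : R.
have psi00 : psi0 q0 != 0 by rewrite gt_eqF // cube_bump_gt0.
pose psi q := if `[< dom q0 q >] then (psi0 q0)^-1 * psi0 q else 0.
have Opsi q : (~` (chart_inv q0 @` A)) q -> psi q = 0.
  rewrite /psi; case: asboolP => // qd Kq.
  have [->|/(cube_bump_neq0 r0) H] := eqVneq (psi0 q) 0; first by rewrite mulr0.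
  by exfalso; apply: Kq; exists (chart q0 q) => //; exact: chartK.
have Od q : ~ dom q0 q -> (~` (chart_inv q0 @` A)) q.
  move=> qd [y /sA[p pd <-]]; rewrite (chartK pd) => pq.
  by apply: qd; rewrite -pq.
exists psi, (~` (chart_inv q0 @` A)); split => //.
- apply/smooth_funP => p; have [pd|pd] := pselect (dom q0 p).
    apply: (@near_eq_smooth_near R d M R^o (fun q => (psi0 q0)^-1 * psi0 q)).
      by apply: filterS (near_dom pd) => q qd; rewrite /psi; case: asboolP.
    apply: smooth_atM; first exact: smooth_at_cst.
    exact: (smooth_near_comp (smooth_near_chart pd) (smooth_cube_bump c r _)).
  apply: near_eq_smooth_near (smooth_at_cst 0 _).
  have : open_nbhs p (~` (chart_inv q0 @` A)).
    by split; [exact: closed_openC|exact: Od].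
  by move=> /open_nbhs_nbhs; apply: filterS => q /Opsi ->.
- by rewrite /psi; case: asboolP => // _; rewrite mulVf.
- exact: closed_openC.
Qed.

End bump.

(** * Local frames and tensoriality *)

Section frame.
Variables (R : realType) (n : nat) (N : manifold R n).

(** Metrics and connections are only controlled on smooth global sections, so a
    local frame and the coefficients of a section in it have to be globally
    defined.  In frame_exists both the coordinate fields of a chart and the
    components in this chart are multiplied by a bump function; fweight, which
    makes up for that in frameE, is the square of the bump function. *)
Record frame (q0 : N) := Frame {
  fweight : N -> R;
  fvec : 'I_n -> N -> 'rV[R]_n;
  fcoef : 'I_n -> N -> 'rV[R]_n -> R;
  fweight_smooth : smooth_fun fweight;
  fweight1 : fweight q0 = 1;
  fvec_smooth : forall i, smooth_field (fvec i);
  frameE : forall q v, fweight q *: v = \sum_i fcoef i q v *: fvec i q;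
  fvec_free : forall q, fweight q != 0 -> forall c : 'I_n -> R,
    \sum_i c i *: fvec i q = 0 -> forall i, c i = 0;
  fcoef_smooth : forall d (M : manifold R d) (F : M -> N) s,
    smooth_map F -> smooth_along F s ->
    forall i, smooth_fun (fun p => fcoef i (F p) (s p)) }.

Lemma frame_exists (q0 : N) : inhabited (frame q0).
Proof.
have [psi [U [spsi psi1 oU dU psi0]]] := manifold_bump q0.
pose e i : 'rV[R]_n := delta_mx 0 i.
pose E i q := psi q *: vec_of q0 q (e i).
pose co (i : 'I_n) q v : R := psi q * dirder q v (chart q0) 0 i.
have nO q : ~ dom q0 q -> \forall q' \near q, U q'.
  by move=> /dU Uq; exact: open_nbhs_nbhs.
have vec_sum q (c : 'I_n -> R) : dom q0 q ->
    \sum_i c i *: E i q = psi q *: vec_of q0 q (\row_i c i).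
  move=> qd; have lv := vec_of_linear qd.
  have lin0 : vec_of q0 q 0 = 0 by rewrite /vec_of derive0.
  have linS (r : seq 'I_n) : vec_of q0 q (\sum_(i <- r) c i *: e i) =
      \sum_(i <- r) c i *: vec_of q0 q (e i).
    elim: r => [|i r IH]; first by rewrite !big_nil.
    by rewrite !big_cons lv IH.
  have -> : \row_i c i = \sum_i c i *: e i.
    by rewrite [LHS]row_sum_delta; apply: eq_bigr => i _; rewrite mxE.
  rewrite linS scaler_sumr; apply: eq_bigr => i _.
  by rewrite /E !scalerA mulrC.
constructor; apply: (@Frame q0 (fun q => psi q * psi q) E co).
- exact: smooth_funM.
- by rewrite psi1 mulr1.
- move=> i; apply: (smooth_along_chart (@smooth_map_id R n N)) => p /=.
  have [pd|pd] := pselect (dom q0 p).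
    exists q0 => //; have /smooth_funP sp := spsi.
    apply: near_eq_smooth_near (smooth_atZ (sp p) (smooth_at_cst (e i) _)).
    apply: filterS (near_dom pd) => q qd /=.
    by rewrite /E dirderZ ?vec_ofK //; exact: smooth_near_chart.
  exists p; first exact: dom_center.
  apply: near_eq_smooth_near (smooth_at_cst 0 _).
  by apply: filterS (nO _ pd) => q /psi0 q0_; rewrite /E q0_ scale0r dirder0.
- move=> q v; have [qd|/dU/psi0 p0] := pselect (dom q0 q); last first.
    rewrite p0 mulr0 scale0r big1 // => i _.
    by rewrite /co p0 mul0r scale0r.
  rewrite vec_sum // (_ : \row_i co i q v = psi q *: dirder q v (chart q0)).
    have lin0 : vec_of q0 q 0 = 0 by rewrite /vec_of derive0.
    have := vec_of_linear qd (psi q) (dirder q v (chart q0)) 0.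
    rewrite lin0 dirderK // [_ + 0]addr0 [psi q *: v + 0]addr0 => ->.
    by rewrite scalerA.
  by apply/rowP => i; rewrite !mxE.
- move=> q pq c; have [qd|/dU/psi0 p0] := pselect (dom q0 q); last first.
    by rewrite p0 mulr0 eqxx in pq.
  have {}pq : psi q != 0 by apply: contra_neq pq => ->; rewrite mulr0.
  rewrite vec_sum // => /eqP; rewrite scaler_eq0 (negbTE pq) /= => /eqP H i.
  have := vec_ofK (\row_i c i) qd; rewrite H dirder0 => /rowP/(_ i).
  by rewrite !mxE => <-.
- move=> d M F s sF ss i; apply/smooth_funP => p.
  have [pd|pd] := pselect (dom q0 (F p)).
    have /smooth_funP sp := smooth_fun_map sF spsi.
    have /(smooth_alongP sF)/(_ p q0 pd)/smooth_at_coordP/(_ i) sc := ss.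
    exact: (smooth_atM (sp p) sc).
  have cF : continuous F by case: sF.
  apply: (@near_eq_smooth_near R d M R^o (fun=> 0)); last exact: smooth_at_cst.
  have nU : \forall q \near p, U (F q) := cF p _ (nO _ pd).
  apply: filterS nU => q /psi0 q0_.
  by rewrite /co q0_ mul0r.
Qed.

Lemma extend_vector (q : N) (v : 'rV[R]_n) :
  exists2 Z, smooth_field Z & Z q = v.
Proof.
have [f] := frame_exists q.
exists (fun q' => \sum_i fcoef f i q v *: fvec f i q').
  apply: (smooth_along_sum (@smooth_map_id R n N)) => i _.
  apply: (smooth_alongZ (@smooth_map_id R n N)); first exact: smooth_fun_cst.
  exact: fvec_smooth.
by rewrite -frameE fweight1 scale1r.
Qed.

End frame.

Section tensor.
Variables (R : realType) (d n : nat) (M : manifold R d) (N : manifold R n).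
Variables (F : M -> N) (sF : smooth_map F) (p : M).
Variable Phi : (M -> 'rV[R]_n) -> R.
Hypothesis PhiD : forall s t, smooth_along F s -> smooth_along F t ->
  Phi (fun q => s q + t q) = Phi s + Phi t.
Hypothesis PhiZ : forall f s, smooth_fun f -> smooth_along F s ->
  Phi (fun q => f q *: s q) = f p * Phi s.

(** Let E_i and c_i be the vectors and coefficients of a frame whose weight w
    satisfies w (F p) = 1.  Then Phi s = Phi (w s) = sum_i c_i (s p) Phi (E_i),
    and s enters this expression through s p only.  The weight is what allows
    Phi to be defined on global sections only. *)
Lemma tensor_eq s t : smooth_along F s -> smooth_along F t -> s p = t p ->
  Phi s = Phi t.
Proof.
have [f] := frame_exists (F p).
suff H u : smooth_along F u ->
    Phi u = \sum_i fcoef f i (F p) (u p) * Phi (fvec f i \o F).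
  by move=> ss st e; rewrite !H // e.
move=> su.
have sw := smooth_fun_map sF (fweight_smooth f).
have Phi0 : Phi (fun=> 0) = 0.
  rewrite -[RHS](mul0r (Phi u)) -(PhiZ (@smooth_fun_cst R d M 0) su).
  by congr Phi; apply/funext => q; rewrite scale0r.
have sE i : smooth_along F (fvec f i \o F).
  by apply: smooth_along_comp => //; exact: fvec_smooth.
have sc i := fcoef_smooth f sF su i.
have PhiS (r : seq 'I_n) :
    Phi (fun q => \sum_(i <- r) fcoef f i (F q) (u q) *: fvec f i (F q)) =
    \sum_(i <- r) fcoef f i (F p) (u p) * Phi (fvec f i \o F).
  elim: r => [|i r IH].
    by under eq_fun do rewrite big_nil; rewrite big_nil.
  under eq_fun do rewrite big_cons.
  rewrite big_cons -IH -(PhiZ (sc i) (sE i)); apply: PhiD.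
    exact: (smooth_alongZ sF (sc i) (sE i)).
  apply: (smooth_along_sum sF) => j _.
  exact: (smooth_alongZ sF (sc j) (sE j)).
rewrite -PhiS -[LHS]mul1r -(fweight1 f) -[fweight f (F p)]/((fweight f \o F) p).
rewrite -(PhiZ sw su); congr Phi; apply/funext => q; exact: frameE.
Qed.

End tensor.

(** * Riemannian metrics and the vertical projection *)

Section metric.
Variables (R : realType) (d : nat) (M : manifold R d).
Variable g : M -> 'rV[R]_d -> 'rV[R]_d -> R.
Hypothesis hg : riemannian_metric g.

Lemma metric0l p w : g p 0 w = 0.
Proof.
have := metric_linear hg p (-1) 0 0 w.
by rewrite scaler0 addr0 mulN1r addNr.
Qed.

Lemma metricDl p u v w : g p (u + v) w = g p u w + g p v w.
Proof. by have := metric_linear hg p 1 u v w; rewrite scale1r mul1r. Qed.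

Lemma metricZl p c u w : g p (c *: u) w = c * g p u w.
Proof. by have := metric_linear hg p c u 0 w; rewrite metric0l !addr0. Qed.

Lemma metricNl p u w : g p (- u) w = - g p u w.
Proof. by rewrite -scaleN1r metricZl mulN1r. Qed.

Lemma metricBl p u v w : g p (u - v) w = g p u w - g p v w.
Proof. by rewrite metricDl metricNl. Qed.

Lemma metric_suml p (I : Type) (r : seq I) (P : pred I) (u : I -> 'rV[R]_d) w :
  g p (\sum_(i <- r | P i) u i) w = \sum_(i <- r | P i) g p (u i) w.
Proof.
elim: r => [|i r IH]; first by rewrite !big_nil metric0l.
by rewrite !big_cons; case: ifP => // _; rewrite metricDl IH.
Qed.

Lemma metricDr p u v w : g p w (u + v) = g p w u + g p w v.
Proof. by rewrite !(Defs.metric_sym hg p w) metricDl. Qed.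

Lemma metricZr p c u w : g p w (c *: u) = c * g p w u.
Proof. by rewrite !(Defs.metric_sym hg p w) metricZl. Qed.

Lemma metricNr p u w : g p w (- u) = - g p w u.
Proof. by rewrite !(Defs.metric_sym hg p w) metricNl. Qed.

Lemma metricBr p u v w : g p w (u - v) = g p w u - g p w v.
Proof. by rewrite metricDr metricNr. Qed.

Lemma metric_sumr p (I : Type) (r : seq I) (P : pred I) (u : I -> 'rV[R]_d) w :
  g p w (\sum_(i <- r | P i) u i) = \sum_(i <- r | P i) g p w (u i).
Proof.
rewrite (Defs.metric_sym hg) metric_suml; apply: eq_bigr => i _.
exact: (Defs.metric_sym hg).
Qed.

Lemma metric_sqrD p u v : g p (u + v) (u + v) = g p u u + 2 * g p u v + g p v v.
Proof.
rewrite metricDl !metricDr (Defs.metric_sym hg p v u); ring.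
Qed.

Lemma metric_eq0 p u : g p u u = 0 -> u = 0.
Proof.
by move=> g0; have [//|/(metric_pos hg p)] := eqVneq u 0; rewrite g0 ltxx.
Qed.

(** The difference of two candidates lies in D p and is orthogonal to it. *)
Lemma orth_projE (D : M -> set 'rV[R]_d) p v w :
  (forall u u', D p u -> D p u' -> D p (u - u')) ->
  D p w -> orth g D p (v - w) -> orth_proj g D p v = w.
Proof.
move=> DB Dw ow; rewrite /orth_proj.
apply: xget_unique => // w' [Dw' ow'].
have Dd := DB _ _ Dw' Dw.
apply/eqP; rewrite -subr_eq0; apply/eqP/(metric_eq0 (p := p)).
have e : w' - w = (v - w) - (v - w') by rewrite opprB [RHS]addrC subrKA.
by rewrite {1}e metricBl (ow _ Dd) (ow' _ Dd) subrr.
Qed.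

Lemma orthB (D : M -> set 'rV[R]_d) p u v :
  orth g D p u -> orth g D p v -> orth g D p (u - v).
Proof. by move=> ou ov w Dw; rewrite metricBl ou // ov // subrr. Qed.

End metric.

Section pullback_metric.
Variables (R : realType) (d n : nat) (M : manifold R d) (N : manifold R n).
Variables (F : M -> N) (sF : smooth_map F).
Variable g : N -> 'rV[R]_n -> 'rV[R]_n -> R.
Hypothesis hg : riemannian_metric g.

(** Written in a frame, the product is a sum of products of smooth
    coefficients and of values of the metric on fields of N. *)
Lemma smooth_metric_along s t : smooth_along F s -> smooth_along F t ->
  smooth_fun (fun p => g (F p) (s p) (t p)).
Proof.
move=> ss st; apply: smooth_fun_div => p.
have [f] := frame_exists (F p).
have sw := smooth_fun_map sF (fweight_smooth f).
exists (fun q => fweight f (F q) * fweight f (F q)).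
exists (fun q => \sum_i fcoef f i (F q) (s q) *
  \sum_j fcoef f j (F q) (t q) * g (F q) (fvec f i (F q)) (fvec f j (F q))).
split.
- exact: (smooth_funM sw sw).
- apply: smooth_fun_sum => i _; apply: smooth_funM; first exact: fcoef_smooth.
  apply: smooth_fun_sum => j _; apply: smooth_funM; first exact: fcoef_smooth.
  apply: (smooth_fun_map sF (f := fun q => g q (fvec f i q) (fvec f j q))).
  by apply: (metric_smooth hg); exact: fvec_smooth.
- by rewrite (fweight1 f) mulr1 oner_eq0.
- near=> q.
  rewrite -mulrA -(metricZr hg) -(metricZl hg) !frameE (metric_suml hg).
  apply: eq_bigr => i _; rewrite (metricZl hg) (metric_sumr hg); congr (_ * _).
  by apply: eq_bigr => j _; rewrite (metricZr hg).
Unshelve. all: by end_near. Qed.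

End pullback_metric.

Section push.
Variables (R : realType) (d n : nat) (M : manifold R d) (N : manifold R n).
Variables (F : M -> N) (sF : smooth_map F).

Let sc p := smooth_map_chart sF (dom_center (F p)).

Lemma push0 p : push F p 0 = 0.
Proof. exact: dirder0. Qed.

Lemma pushD p u v : push F p (u + v) = push F p u + push F p v.
Proof. exact: dirderD (sc p). Qed.

Lemma pushZ p c v : push F p (c *: v) = c *: push F p v.
Proof. exact: dirderZ (sc p). Qed.

Lemma pushN p v : push F p (- v) = - push F p v.
Proof. by rewrite -scaleN1r pushZ scaleN1r. Qed.

Lemma pushB p u v : push F p (u - v) = push F p u - push F p v.
Proof. by rewrite pushD pushN. Qed.

Lemma push_sum p (I : Type) (r : seq I) (P : pred I) (v : I -> 'rV[R]_d) :
  push F p (\sum_(i <- r | P i) v i) = \sum_(i <- r | P i) push F p (v i).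
Proof. exact: dirder_sum (sc p). Qed.

Lemma smooth_push X : smooth_field X ->
  smooth_along F (fun q => push F q (X q)).
Proof.
move=> sX; apply/(smooth_alongP sF) => p b bp.
have := smooth_along_dirder (@smooth_map_id R d M) sX (smooth_map_chart sF bp).
apply: near_eq_smooth_near; apply: filterS (near_map_dom sF bp) => q bq /=.
by rewrite (dirder_push sF) //; exact: smooth_near_chart.
Qed.

End push.

Section vertical_projection.
Variables (R : realType) (d n : nat) (M : manifold R d) (N : manifold R n).
Variables (F : M -> N) (sF : smooth_map F).
Hypothesis rkF : forall p (w : 'rV[R]_n), exists v, push F p v = w.
Variable g : M -> 'rV[R]_d -> 'rV[R]_d -> R.
Hypothesis hg : riemannian_metric g.

Section at_point.
Variables (p0 : M) (fM : frame p0) (fN : frame (F p0)).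

Let E i q := fvec fM i q.
Let E' j q := fvec fN j (F q).
Let comb q (c : 'rV[R]_d) := \sum_i c 0 i *: E i q.

Let G q : 'M[R]_d := \matrix_(i, j) g q (E i q) (E j q).
Let P q : 'M[R]_(d, n) := \matrix_(i, j) fcoef fN j (F q) (push F q (E i q)).
(* The vertical part of v has components c with c G + l P^T = (g v E_j)_j and
   c P = 0, where l is a vector of Lagrange multipliers: the first equation
   says that the remainder is orthogonal to the kernel of P, the second that c
   belongs to it.  The matrix of this system in (c, l) is K. *)
Let K q : 'M[R]_(d + n) := block_mx (G q) (P q) (P q)^T 0.

Let metric_comb q c v : g q (comb q c) v = \sum_i c 0 i * g q (E i q) v.
Proof.
rewrite (metric_suml hg); apply: eq_bigr => i _; exact: metricZl.
Qed.

Let metric_comb_vec q c j : g q (comb q c) (E j q) = (c *m G q) 0 j.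
Proof.
by rewrite metric_comb mxE; apply: eq_bigr => i _; rewrite mxE.
Qed.

Let push_comb q c :
  fweight fN (F q) *: push F q (comb q c) = \sum_j (c *m P q) 0 j *: E' j q.
Proof.
rewrite push_sum // scaler_sumr.
under eq_bigr => i _ do
  rewrite pushZ // scalerA mulrC -scalerA frameE scaler_sumr.
rewrite exchange_big; apply: eq_bigr => j _; rewrite mxE scaler_suml.
by apply: eq_bigr => i _; rewrite scalerA mxE.
Qed.

Let comb_coef q v : fweight fM q *: v = comb q (\row_i fcoef fM i q v).
Proof. by rewrite frameE; apply: eq_bigr => i _; rewrite mxE. Qed.

Let comb_free q c : fweight fM q != 0 -> comb q c = 0 -> c = 0.
Proof.
by move=> wM c0; apply/rowP => i; rewrite mxE; exact: (fvec_free wM c0).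
Qed.

Let comb'_free q (c : 'rV[R]_n) : fweight fN (F q) != 0 ->
  \sum_j c 0 j *: E' j q = 0 -> c = 0.
Proof.
by move=> wN c0; apply/rowP => j; rewrite mxE; exact: (fvec_free wN c0).
Qed.

Let push_comb0 q c : fweight fN (F q) != 0 ->
  push F q (comb q c) = 0 <-> c *m P q = 0.
Proof.
move=> wN; split=> [c0|cP].
  by apply: (comb'_free wN); rewrite -push_comb c0 scaler0.
have := push_comb q c; rewrite cP big1 => [/eqP|j _].
  by rewrite scaler_eq0 (negbTE wN) => /eqP.
by rewrite mxE scale0r.
Qed.

(* If (w, l) K = 0 then the vector with components w is vertical and has
   norm - l (w P)^T = 0, so w = 0; and l P^T = 0 forces l = 0, because the
   surjectivity of F_* gives P full column rank. *)
Let K_unit q : fweight fM q != 0 -> fweight fN (F q) != 0 -> K q \in unitmx.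
Proof.
move=> wM wN; rewrite -row_free_unit -kermx_eq0.
apply/eqP/row_matrixP => i; rewrite row0.
have : row i (kermx (K q)) *m K q = 0 by rewrite -row_mul mulmx_ker row0.
set z := row i _; rewrite -[z]hsubmxK; set w := lsubmx z; set l := rsubmx z.
rewrite mul_row_block mulmx0 addr0 -[0]row_mx0 => /eq_row_mx[wG wP].
have u0 : push F q (comb q w) = 0 by apply/push_comb0.
have w0 : w = 0.
  apply: (comb_free wM); apply: (metric_eq0 hg (p := q)).
  transitivity ((w *m G q *m w^T) 0 0).
    rewrite [RHS]mxE (metric_sumr hg); apply: eq_bigr => j _.
    by rewrite (metricZr hg) metric_comb_vec [w^T _ _]mxE mulrC.
  have -> : w *m G q = - (l *m (P q)^T) by apply/eqP; rewrite -addr_eq0 wG.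
  by rewrite mulNmx -mulmxA -trmx_mul wP trmx0 mulmx0 oppr0 mxE.
rewrite w0 mul0mx add0r in wG.
suff -> : l = 0 by rewrite w0 row_mx0.
apply/rowP => k; rewrite [RHS]mxE.
have [v pv] := rkF q (E' k q).
pose c := \row_i fcoef fM i q v.
set a := fweight fN (F q) * fweight fM q.
have cP : c *m P q = a *: delta_mx 0 k.
  apply/eqP; rewrite -subr_eq0; apply/eqP/(comb'_free wN).
  under eq_bigr => j _ do rewrite mxE scalerDl.
  rewrite big_split /= -push_comb -comb_coef pushZ // scalerA pv.
  rewrite (bigD1 k) //= big1 => [|j jk].
    by rewrite !mxE !eqxx mulr1 addr0 -scalerDl subrr scale0r.
  by rewrite !mxE (negbTE jk) andbF mulr0 oppr0 scale0r.
have : (l *m (P q)^T *m c^T) 0 0 = 0 by rewrite wG mul0mx mxE.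
rewrite -mulmxA -trmx_mul cP linearZ /= trmx_delta -scalemxAr mxE -colE mxE.
by move/eqP; rewrite /a !mulf_eq0 (negbTE wM) (negbTE wN) => /eqP.
Qed.

Let rhs q v : 'rV[R]_(d + n) := row_mx (\row_j g q v (E j q)) 0.

Lemma vertical_system q v :
  fweight fM q != 0 -> fweight fN (F q) != 0 ->
  let c := lsubmx (rhs q v *m invmx (K q)) in
  push F q (comb q c) = 0 /\ horizontal g F q (v - comb q c).
Proof.
move=> wM wN c; have KU := K_unit wM wN.
pose l := rsubmx (rhs q v *m invmx (K q)).
have : row_mx c l *m K q = rhs q v by rewrite hsubmxK mulmxKV.
rewrite mul_row_block mulmx0 addr0 => /eq_row_mx[cG cP].
split=> [|u]; first exact/push_comb0.
rewrite /vertical /= => u0.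
set e := \row_i fcoef fM i q u.
have eP : e *m P q = 0.
  by apply/(push_comb0 e wN); rewrite -comb_coef (pushZ sF) u0 scaler0.
apply/eqP; rewrite -(mulrI_eq0 _ (mulfI wM)) -(metricZr hg) comb_coef.
rewrite (metric_sumr hg) -/e.
transitivity (((l *m (P q)^T) *m e^T) 0 0 == 0); last first.
  by rewrite -mulmxA -trmx_mul eP trmx0 mulmx0 mxE eqxx.
congr (_ == 0); rewrite mxE; apply: eq_bigr => j _.
rewrite (metricZr hg) (metricBl hg) metric_comb_vec mulrC.
congr (_ * _); last by rewrite [RHS]mxE.
have := congr1 (fun r : 'rV[R]_d => r 0 j) cG.
rewrite [X in X = _]mxE [X in _ = X]mxE => <-.
by rewrite [X in X - _]addrC addrK.
Qed.

Let sK i j : smooth_fun (fun q => K q i j).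
Proof.
rewrite /K -(fintype.splitK i) -(fintype.splitK j).
case: (fintype.split i) => i'; case: (fintype.split j) => j' /=.
- under eq_fun do rewrite block_mxEul mxE.
  exact: (metric_smooth hg (fvec_smooth fM _) (fvec_smooth fM _)).
- under eq_fun do rewrite block_mxEur mxE.
  by apply: fcoef_smooth => //; apply: smooth_push => //; exact: fvec_smooth.
- under eq_fun do rewrite block_mxEdl !mxE.
  by apply: fcoef_smooth => //; apply: smooth_push => //; exact: fvec_smooth.
- under eq_fun do rewrite block_mxEdr mxE.
  exact: smooth_fun_cst.
Qed.

Let srhs X : smooth_field X ->
  forall i j, smooth_fun (fun q => rhs q (X q) i j).
Proof.
move=> sX i j; rewrite /rhs -(fintype.splitK j).
case: (fintype.split j) => j' /=.
- under eq_fun do rewrite row_mxEl mxE.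
  exact: (metric_smooth hg sX (fvec_smooth fM _)).
- by under eq_fun do rewrite row_mxEr mxE; exact: smooth_fun_cst.
Qed.

Lemma vertical_solution X : smooth_field X ->
  exists (e : M -> R) U, [/\ smooth_fun e, smooth_field U &
    forall q, fweight fM q != 0 -> fweight fN (F q) != 0 ->
      e q != 0 /\ exists w, [/\ push F q w = 0, horizontal g F q (X q - w)
        & e q *: w = U q]].
Proof.
move=> sX; exists (fun q => \det (K q)).
exists (fun q => comb q (lsubmx (rhs q (X q) *m \adj (K q)))); split.
- exact: smooth_fun_det.
- apply: (smooth_along_sum (@smooth_map_id R d M)) => i _.
  apply: (smooth_alongZ (@smooth_map_id R d M)); last exact: fvec_smooth.
  under eq_fun do rewrite mxE.
  by apply: smooth_fun_mulmx; [exact: srhs|exact: smooth_fun_adj].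
- move=> q wM wN; have KU := K_unit wM wN.
  have dK : \det (K q) != 0 by move: KU; rewrite unitmxE unitfE.
  split=> //; have [v0 h0] := vertical_system (X q) wM wN.
  exists (comb q (lsubmx (rhs q (X q) *m invmx (K q)))); split => //.
  have -> : rhs q (X q) *m \adj (K q) =
      \det (K q) *: (rhs q (X q) *m invmx (K q)).
    by rewrite /invmx KU -scalemxAr scalerA mulfV // scale1r.
  by rewrite scaler_sumr; apply: eq_bigr => i _; rewrite scalerA !mxE.
Qed.

End at_point.

Lemma vertical_decomposition p v :
  exists w, push F p w = 0 /\ horizontal g F p (v - w).
Proof.
have [fM] := frame_exists p; have [fN] := frame_exists (F p).
have H := @vertical_system p fM fN p v.
by eexists; apply: H; rewrite fweight1 oner_eq0.
Qed.

Lemma verticalB p u u' : vertical F p u -> vertical F p u' ->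
  vertical F p (u - u').
Proof. by rewrite /vertical /= pushB // => -> ->; rewrite subrr. Qed.

Lemma VprojE X p w : push F p w = 0 -> horizontal g F p (X p - w) ->
  Vproj g F X p = w.
Proof.
move=> w0 hw; apply: (orth_projE hg); [|exact: w0|exact: hw].
by move=> u u'; exact: verticalB.
Qed.

Lemma Vproj_vertical X p : vertical F p (Vproj g F X p).
Proof.
by have [w [w0 hw]] := vertical_decomposition p (X p); rewrite (VprojE w0 hw).
Qed.

Lemma Vproj_horizontal X p : horizontal g F p (X p - Vproj g F X p).
Proof.
by have [w [w0 hw]] := vertical_decomposition p (X p); rewrite (VprojE w0 hw).
Qed.

Lemma HprojE X p : Hproj g F X p = X p - Vproj g F X p.
Proof.
apply: (orth_projE hg).
- by move=> u u'; exact: orthB.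
- exact: Vproj_horizontal.
- rewrite subKr => u hu; rewrite (Defs.metric_sym hg); apply: hu.
  exact: Vproj_vertical.
Qed.

(** Around p the projection solves a linear system with smooth coefficients,
    of determinant e. *)
Lemma smooth_Vproj X : smooth_field X -> smooth_field (Vproj g F X).
Proof.
move=> sX; apply: (smooth_along_div (@smooth_map_id R d M)) => p.
have [fM] := frame_exists p; have [fN] := frame_exists (F p).
have [e [U [se sU H]]] := vertical_solution fM fN sX.
exists e, U; split => //.
  by have [] := H p; rewrite ?fweight1 ?oner_eq0.
have sN := smooth_fun_map sF (fweight_smooth fN).
have nM := @near_smooth_fun_neq0 _ _ M _ p (fweight_smooth fM).
have nN := @near_smooth_fun_neq0 _ _ M _ p sN.
rewrite /= !fweight1 !oner_eq0 in nM nN.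
apply: filterS2 (nM isT) (nN isT) => q wM wN.
by have [_ [w [w0 hw <-]]] := H q wM wN; rewrite (VprojE w0 hw).
Qed.

End vertical_projection.

(** Coordinates multiplied by a bump function are smooth global functions, and
    they separate tangent vectors. *)
Lemma tangent_eq (R : realType) (n : nat) (N : manifold R n) (q : N) u v :
  (forall f : N -> R, smooth_fun f ->
    dirder q u (f : N -> R^o) = dirder q v (f : N -> R^o)) -> u = v.
Proof.
move=> H; have [psi [U [spsi psi1 oU dU psi0]]] := manifold_bump q.
have qq := dom_center q.
apply/rowP => i; pose f (q' : N) : R := psi q' * chart q q' 0 i.
have sch p : dom q p -> smooth_near (fun q' => chart q q' 0 i : R^o) p.
  by move=> pd; have /smooth_at_coordP := smooth_near_chart pd; exact.
have sf : smooth_fun f.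
  apply/smooth_funP => p; have [pd|/dU Up] := pselect (dom q p).
    by have /smooth_funP/(_ p) sp := spsi; exact: (smooth_atM sp (sch _ pd)).
  apply: (@near_eq_smooth_near R n N R^o (fun=> 0)); last exact: smooth_at_cst.
  apply: filterS (open_nbhs_nbhs (conj oU Up)) => q' /psi0 q0_.
  by rewrite /f q0_ mul0r.
have dcoord w : dirder q w (fun q' => chart q q' 0 i : R^o) = w 0 i.
  rewrite -[in RHS](dirder_self q w) /dirder derive_mx; first by rewrite mxE.
  apply: diff_derivable; apply: smooth_at_differentiable.
  exact: (smooth_near_chart qq).
have df w : dirder q w (f : N -> R^o) =
    w 0 i + dirder q w (psi : N -> R^o) * chart q q 0 i.
  have /smooth_funP/(_ q)/smooth_at_differentiable dp := spsi.
  have dch := smooth_at_differentiable (sch _ qq).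
  have [_ /(_ w)] := differentiable_scale dp dch.
  rewrite /= (chartK qq) psi1 scale1r => E.
  by rewrite -[X in X + _]dcoord; exact: E.
by have := H _ sf; rewrite !df (H _ spsi) => /addIr.
Qed.

(** * The pullback connection and the second fundamental form *)

Lemma sub_exchange (R : realType) (a1 a2 b1 b2 c1 c2 d1 d2 e1 e2 : R) :
  a1 - b1 = c1 - d1 -> a2 - b2 = c2 - d2 -> d1 - d2 = c1 - c2 ->
  e1 - e2 = a1 - a2 -> b1 - e1 = b2 - e2.
Proof. lra. Qed.

Lemma skew_exchange (R : realType) (a b c d : R) :
  a + b = c + d -> c - a = - (d - b).
Proof. lra. Qed.

(** The sign pattern of a trilinear form that is symmetric in its first two
    arguments and skew in its last two: a, b and c stand for its values at
    (X, Y, Z), (X, Z, Y) and (Y, Z, X). *)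
Lemma braid (R : realType) (a b c : R) :
  a = - b -> a = - c -> b = - c -> a = 0.
Proof. lra. Qed.

Lemma polarize (R : realType) (a b c a' b' c' : R) :
  a + 2 * b + c = a' + 2 * b' + c' -> a = a' -> c = c' -> b = b'.
Proof. lra. Qed.

Section pullback.
Variables (R : realType) (d n : nat) (M : manifold R d) (N : manifold R n).
Variables (F : M -> N) (sF : smooth_map F).
Variable gN : N -> 'rV[R]_n -> 'rV[R]_n -> R.
Hypothesis hgN : riemannian_metric gN.
Variable nablaN : (N -> 'rV[R]_n) -> (N -> 'rV[R]_n) -> N -> 'rV[R]_n.
Hypothesis hN : levi_civita gN nablaN.
Variable nablaF : (M -> 'rV[R]_d) -> (M -> 'rV[R]_n) -> M -> 'rV[R]_n.
Hypothesis hF : pullback_connection F nablaN nablaF.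

Let cF := pb_connection hF.

Let lie_comp X W (f : N -> R) p : smooth_fun f -> W (F p) = push F p (X p) ->
  lie X (f \o F) p = lie W f (F p).
Proof.
move=> /smooth_funP sf e; rewrite /lie e.
exact: (dirder_push sF (h := (f : N -> R^o))).
Qed.

(** The defect of this product rule is tensorial in s and in t, which may
    therefore be replaced with restrictions of fields of N; for these the rule
    is the compatibility of nablaN with gN. *)
Lemma pullback_metric X s t p :
  smooth_field X -> smooth_along F s -> smooth_along F t ->
  lie X (fun q => gN (F q) (s q) (t q)) p =
  gN (F p) (nablaF X s p) (t p) + gN (F p) (s p) (nablaF X t p).
Proof.
move=> sX ss st.
pose D s t := lie X (fun q => gN (F q) (s q) (t q)) p -
  (gN (F p) (nablaF X s p) (t p) + gN (F p) (s p) (nablaF X t p)).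
suff /eqP : D s t = 0 by rewrite subr_eq0 => /eqP.
have Dsym s1 s2 : D s1 s2 = D s2 s1.
  rewrite /D; under eq_fun do rewrite (Defs.metric_sym hgN).
  by rewrite [X in _ - X]addrC !(Defs.metric_sym hgN _ _ (nablaF _ _ _)).
have Dtensor t1 s1 s2 : smooth_along F t1 -> smooth_along F s1 ->
    smooth_along F s2 -> s1 p = s2 p -> D s1 t1 = D s2 t1.
  move=> st1; apply: (tensor_eq sF (Phi := D^~ t1)) => /=.
    move=> u v su sv; rewrite /D.
    under eq_fun do rewrite (metricDl hgN).
    rewrite lieD; try exact: (smooth_metric_along sF hgN).
    rewrite (conn_addr cF) // !(metricDl hgN); ring.
  move=> f u sf su; rewrite /D.
  under eq_fun do rewrite (metricZl hgN).
  rewrite lieM //; last exact: (smooth_metric_along sF hgN).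
  rewrite (conn_leibniz cF) // !(metricDl hgN) !(metricZl hgN); ring.
have [Zs sZs es] := extend_vector (F p) (s p).
have [Zt sZt et] := extend_vector (F p) (t p).
have [W sW eW] := extend_vector (F p) (push F p (X p)).
have sZsF := smooth_along_comp sF sZs; have sZtF := smooth_along_comp sF sZt.
rewrite (Dtensor t s (Zs \o F)) // Dsym (Dtensor _ t (Zt \o F)) //.
have sg : smooth_fun (fun q => gN q (Zt q) (Zs q)).
  exact: (metric_smooth hgN).
rewrite /D !(pb_compatible hF sX sW) // -(lc_metric hN) // .
by rewrite -(lie_comp sg eW) subrr.
Qed.

(* The Hessian of f along F.  It is tensorial in s, hence equal to the Hessian
   of f on N at any fields that extend F_* X and s at F p, and the latter is
   symmetric because nablaN is torsion free. *)
Let hess X s (f : N -> R) p : R :=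
  lie X (fun q => dirder (F q) (s q) (f : N -> R^o) : R) p -
  dirder (F p) (nablaF X s p) (f : N -> R^o).

Let hessE X s f p W Z : smooth_field X -> smooth_along F s -> smooth_fun f ->
  smooth_field W -> smooth_field Z ->
  W (F p) = push F p (X p) -> Z (F p) = s p ->
  hess X s f p = lie W (lie Z f) (F p) - lie (nablaN W Z) f (F p).
Proof.
move=> sX ss sf sW sZ eW eZ; have /smooth_funP mf := sf.
have slie u : smooth_along F u ->
    smooth_fun (fun q => dirder (F q) (u q) (f : N -> R^o) : R).
  by move=> su; apply/smooth_funP => q; exact: (smooth_along_dirder sF su).
have sZF := smooth_along_comp sF sZ.
have hD u v : smooth_along F u -> smooth_along F v ->
    hess X (fun q => u q + v q) f p = hess X u f p + hess X v f p.
  move=> su sv; rewrite /hess.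
  have -> : (fun q => dirder (F q) (u q + v q) (f : N -> R^o) : R) =
      (fun q => dirder (F q) (u q) (f : N -> R^o) +
                dirder (F q) (v q) (f : N -> R^o)).
    by apply/funext => q; exact: (dirderD _ _ (mf _)).
  rewrite (lieD _ _ (slie _ su) (slie _ sv)) (conn_addr cF sX su sv).
  rewrite (dirderD (nablaF X u p) (nablaF X v p) (mf (F p))).
  by rewrite opprD addrACA.
have hZ h u : smooth_fun h -> smooth_along F u ->
    hess X (fun q => h q *: u q) f p = h p * hess X u f p.
  move=> sh su; rewrite /hess.
  have -> : (fun q => dirder (F q) (h q *: u q) (f : N -> R^o) : R) =
      (fun q => h q * dirder (F q) (u q) (f : N -> R^o)).
    by apply/funext => q; exact: (dirderZ _ _ (mf _)).
  rewrite (lieM _ _ sh (slie _ su)) (conn_leibniz cF sh sX su).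
  rewrite (dirderD (lie X h p *: u p) (h p *: nablaF X u p) (mf (F p))).
  rewrite (dirderZ (lie X h p) (u p) (mf (F p))).
  rewrite (dirderZ (h p) (nablaF X u p) (mf (F p))).
  by rewrite mulrBr opprD addrACA subrr add0r.
rewrite (@tensor_eq _ _ _ _ _ _ sF p (fun u => hess X u f p) hD hZ
  s (Z \o F) ss sZF (esym eZ)).
have sl : smooth_fun (lie Z f).
  apply/smooth_funP => q.
  exact: (smooth_along_dirder (@smooth_map_id R n N) sZ).
rewrite /hess (pb_compatible hF sX sW sZ eW).
exact: (congr1 (fun x => x - lie (nablaN W Z) f (F p)) (lie_comp sl eW)).
Qed.

Variable gM : M -> 'rV[R]_d -> 'rV[R]_d -> R.
Variable nablaM : (M -> 'rV[R]_d) -> (M -> 'rV[R]_d) -> M -> 'rV[R]_d.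
Hypothesis hM : levi_civita gM nablaM.

(** The symmetry of the Hessian along F says that the pullback connection is
    torsion free.  Together with the torsion freeness of nablaM, tested on
    functions of the form f o F, this gives the symmetry. *)
Lemma second_fundamental_form_sym X Y p : smooth_field X -> smooth_field Y ->
  second_fundamental_form F nablaM nablaF X Y p =
  second_fundamental_form F nablaM nablaF Y X p.
Proof.
move=> sX sY; apply: tangent_eq => f sf; have /smooth_funP mf := sf.
have sFX := smooth_push sF sX; have sFY := smooth_push sF sY.
have [Z sZ eZ] := extend_vector (F p) (push F p (Y p)).
have [W sW eW] := extend_vector (F p) (push F p (X p)).
have h1 := hessE sX sFY sf sW sZ eW eZ.
have h2 := hessE sY sFX sf sZ sW eZ eW.
have tN := lc_torsion_free hN sW sZ sf (F p).
have sfF := smooth_fun_map sF sf.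
have tM := lc_torsion_free hM sX sY sfF p.
have push_lie U q : dirder (F q) (push F q (U q)) (f : N -> R^o) =
    lie U (f \o F) q.
  by rewrite /lie (dirder_push sF (h := (f : N -> R^o))).
have push_lieE U : (fun q => dirder (F q) (push F q (U q)) (f : N -> R^o) : R) =
    lie U (f \o F) by apply/funext => q; exact: push_lie.
rewrite /hess push_lieE in h1; rewrite /hess push_lieE in h2.
rewrite /second_fundamental_form.
have s1 := dirderB (nablaF X (fun q => push F q (Y q)) p)
  (push F p (nablaM X Y p)) (mf (F p)).
have s2 := dirderB (nablaF Y (fun q => push F q (X q)) p)
  (push F p (nablaM Y X p)) (mf (F p)).
apply: (etrans s1); apply: esym; apply: (etrans s2).
have l1 := push_lie (nablaM X Y) p; have l2 := push_lie (nablaM Y X) p.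
apply: (etrans (congr1 (fun r => _ - r) l2)); apply: esym.
apply: (etrans (congr1 (fun r => _ - r) l1)).
exact: sub_exchange h1 h2 tN tM.
Qed.

End pullback.

Section submersion.
Variables (R : realType) (d n : nat) (M : manifold R d) (N : manifold R n).
Variable F : M -> N.
Variables (gM : M -> 'rV[R]_d -> 'rV[R]_d -> R)
  (gN : N -> 'rV[R]_n -> 'rV[R]_n -> R).
Hypotheses (hgM : riemannian_metric gM) (hgN : riemannian_metric gN).
Hypothesis hF : riemannian_submersion gM gN F.
Let sF := subm_smooth hF.
Let rkF := subm_rank hF.

(** The isometry condition gives the case of a horizontal v by polarization,
    and the vertical part of v contributes to neither side. *)
Lemma push_isometry p v z : horizontal gM F p z ->
  gN (F p) (push F p v) (push F p z) = gM p v z.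
Proof.
move=> hz; have [w [w0 hw]] := vertical_decomposition sF rkF hgM p v.
have -> : push F p v = push F p (v - w) by rewrite pushB // w0 subr0.
have -> : gM p v z = gM p (v - w) z.
  by rewrite (metricBl hgM) (Defs.metric_sym hgM p w) hz // subr0.
set u := v - w in hw *.
have hs : horizontal gM F p (u + z).
  by move=> x Vx; rewrite (metricDl hgM) hw // hz // addr0.
have i := subm_isometry hF hs.
have i' : gN (F p) (push F p u + push F p z) (push F p u + push F p z) =
    gM p (u + z) (u + z) by rewrite -i (pushD sF).
exact: (polarize (etrans (etrans (esym (metric_sqrD hgN _ _ _)) i')
  (metric_sqrD hgM _ _ _)) (subm_isometry hF hw) (subm_isometry hF hz)).
Qed.

Variables (nablaM : (M -> 'rV[R]_d) -> (M -> 'rV[R]_d) -> M -> 'rV[R]_d)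
  (nablaN : (N -> 'rV[R]_n) -> (N -> 'rV[R]_n) -> N -> 'rV[R]_n)
  (nablaF : (M -> 'rV[R]_d) -> (M -> 'rV[R]_n) -> M -> 'rV[R]_n).
Hypotheses (hM : levi_civita gM nablaM) (hN : levi_civita gN nablaN).
Hypothesis hnablaF : pullback_connection F nablaN nablaF.

Let sff := second_fundamental_form F nablaM nablaF.
Let T X Y Z p := gN (F p) (sff X Y p) (push F p (Z p)).

Let T_skew X Y Z p : smooth_field X ->
  section_of (horizontal gM F) Y -> section_of (horizontal gM F) Z ->
  T X Y Z p = - T X Z Y p.
Proof.
move=> sX [sY hY] [sZ hZ].
have := pullback_metric sF hgN hN hnablaF p sX
  (smooth_push sF sY) (smooth_push sF sZ).
have -> : (fun q => gN (F q) (push F q (Y q)) (push F q (Z q))) =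
    (fun q => gM q (Y q) (Z q)).
  by apply/funext => q; exact: push_isometry.
rewrite (lc_metric hM) // => E.
have TE U V : horizontal gM F p (V p) -> T X U V p =
    gN (F p) (nablaF X (fun q => push F q (U q)) p) (push F p (V p)) -
    gM p (nablaM X U p) (V p).
  move=> hV; rewrite /T /sff /second_fundamental_form (metricBl hgN).
  by congr (_ - _); exact: push_isometry.
rewrite (TE _ _ (hZ p)) (TE _ _ (hY p)).
move: E; rewrite (Defs.metric_sym hgN _ (push F p (Y p))).
rewrite (Defs.metric_sym hgM _ (Y p)); exact: skew_exchange.
Qed.

(** F_* preserves scalar products of horizontal fields, and both connections
    are metric; this makes the trilinear form T skew in its last two arguments.
    It is symmetric in the first two by second_fundamental_form_sym. *)
Lemma second_fundamental_form_horizontal X Y Z p :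
  section_of (horizontal gM F) X -> section_of (horizontal gM F) Y ->
  section_of (horizontal gM F) Z ->
  gN (F p) (second_fundamental_form F nablaM nablaF X Y p) (push F p (Z p)) = 0.
Proof.
move=> hX hY hZ; rewrite -/sff -/(T X Y Z p).
have [sX _] := hX; have [sY _] := hY; have [sZ _] := hZ.
have Tsym U V W : smooth_field U -> smooth_field V -> T U V W p = T V U W p.
  move=> sU sV; rewrite /T /sff.
  by rewrite (second_fundamental_form_sym sF hN hnablaF hM).
have s1 := T_skew p sX hY hZ.
have s2 := etrans (Tsym X Y Z sX sY) (T_skew p sY hX hZ).
have s3 := etrans (Tsym X Z Y sX sZ) (T_skew p sZ hX hY).
rewrite (Tsym Z Y X sZ sY) in s3.
exact: braid s1 s2 s3.
Qed.

End submersion.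

(** * Anti-invariant submersions from Kenmotsu manifolds *)

Section anti_invariant_submersion.
Variables (R : realType) (m n : nat).
Variables (M : manifold R m.*2.+1) (N : manifold R n).
Variable phi : M -> {linear 'rV[R]_(m.*2.+1) -> 'rV[R]_(m.*2.+1)}.
Variable xi : M -> 'rV[R]_(m.*2.+1).
Variable eta : M -> {linear 'rV[R]_(m.*2.+1) -> R^o}.
Variable gM : M -> 'rV[R]_(m.*2.+1) -> 'rV[R]_(m.*2.+1) -> R.
Variable gN : N -> 'rV[R]_n -> 'rV[R]_n -> R.
Variable nablaM : (M -> 'rV[R]_(m.*2.+1)) -> (M -> 'rV[R]_(m.*2.+1)) ->
  M -> 'rV[R]_(m.*2.+1).
Variable F : M -> N.
Hypothesis hM : kenmotsu phi xi eta gM nablaM.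
Hypothesis hF : riemannian_submersion gM gN F.
Hypothesis hanti : anti_invariant phi gM F.
Hypothesis hxi : forall p, horizontal gM F p (xi p).

Let hacm := ken_acm hM.
Let hg := acm_metric hacm.
Let hlc := ken_lc hM.
Let hcon := lc_connection hlc.
Let sF := subm_smooth hF.
Let rkF := subm_rank hF.
Let A := oneillA gM F nablaM.
Let B := Bpart phi gM F.
Let C := Cpart phi gM F.
Let phif (X : M -> 'rV[R]_(m.*2.+1)) q := phi q (X q).

Implicit Types X Y V W : M -> 'rV[R]_(m.*2.+1).

Let eta_vertical p v : vertical F p v -> eta p v = 0.
Proof.
by move=> Vv; rewrite (acm_eta_dual hacm) (Defs.metric_sym hg) hxi.
Qed.

Let Vproj_horizontal0 X q : horizontal gM F q (X q) -> Vproj gM F X q = 0.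
Proof.
by move=> hX; apply: (VprojE sF hg); rewrite ?push0 ?subr0.
Qed.

Let Vproj_id X q : vertical F q (X q) -> Vproj gM F X q = X q.
Proof.
move=> vX; apply: (VprojE sF hg) => //; rewrite subrr => u _.
exact: metric0l.
Qed.

Let metric_Hproj W p v : horizontal gM F p v ->
  gM p (Hproj gM F W p) v = gM p (W p) v.
Proof.
move=> hv; rewrite (HprojE sF rkF hg) (metricBl hg).
rewrite [X in _ - X](Defs.metric_sym hg).
by rewrite hv ?subr0 //; exact: Vproj_vertical.
Qed.

Lemma smooth_phi Y : smooth_field Y -> smooth_field (phif Y).
Proof. exact: (acm_phi_smooth hacm). Qed.

Lemma smooth_B Y : smooth_field Y -> smooth_field (B Y).
Proof. by move=> sY; apply: (smooth_Vproj sF rkF hg); exact: smooth_phi. Qed.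

Let C_E Y p : C Y p = phif Y p - B Y p.
Proof. exact: (HprojE sF rkF hg). Qed.

Let phi_BC Y : phif Y = (fun q => B Y q + C Y q).
Proof. by apply/funext => q; rewrite C_E addrC subrK. Qed.

Lemma smooth_C Y : smooth_field Y -> smooth_field (C Y).
Proof.
move=> sY; rewrite (_ : C Y = (fun q => phif Y q + (-1) *: B Y q)).
  apply: (smooth_alongD (@smooth_map_id R _ M)); first exact: smooth_phi.
  apply: (smooth_alongZ (@smooth_map_id R _ M)); first exact: smooth_fun_cst.
  exact: smooth_B.
by apply/funext => q; rewrite C_E scaleN1r.
Qed.

Let B_vertical Y p : vertical F p (B Y p).
Proof. exact: (Vproj_vertical sF rkF hg). Qed.

Let C_horizontal Y p : horizontal gM F p (C Y p).
Proof. by rewrite C_E; exact: (Vproj_horizontal sF rkF hg). Qed.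

Lemma C_section Y : section_of (horizontal gM F) Y ->
  section_of (horizontal gM F) (C Y).
Proof.
by move=> [sY _]; split=> [|p]; [exact: smooth_C|exact: C_horizontal].
Qed.

Lemma phi_section V : section_of (vertical F) V ->
  section_of (horizontal gM F) (phif V).
Proof. by move=> [sV vV]; split=> [|p]; [exact: smooth_phi|exact: hanti]. Qed.

(** By compatibility g (phi Y) (phi u) = g Y u - eta Y * eta u, where both
    terms vanish for u vertical, and phi u is orthogonal to B Y. *)
Lemma C_orth_phi Y p u : horizontal gM F p (Y p) -> vertical F p u ->
  gM p (C Y p) (phi p u) = 0.
Proof.
move=> hY vu; rewrite C_E (metricBl hg) /phif (acm_compat hacm) (hY u vu).
rewrite (eta_vertical vu) mulr0 subr0 (Defs.metric_sym hg).
by rewrite (hanti vu (B_vertical Y p)) subrr.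
Qed.

Lemma eta_C Y p : eta p (C Y p) = 0.
Proof.
rewrite C_E linearB /= (acm_eta_phi hacm) (eta_vertical (B_vertical Y p)).
exact: subr0.
Qed.

(** As B Y is vertical, A_X (B Y) differs from nabla_X (B Y) by vertical
    vectors, which are orthogonal to phi V. *)
Lemma oneillA_Bpart X Y V p :
  section_of (horizontal gM F) X -> section_of (horizontal gM F) Y ->
  section_of (vertical F) V ->
  gM p (A X (B Y) p) (phi p (V p)) = gM p (nablaM X (B Y) p) (phi p (V p)).
Proof.
move=> [sX hX] [sY hY] [sV vV]; have hphi := hanti (vV p).
have HX : Hproj gM F X = X.
  apply/funext => q; rewrite (HprojE sF rkF hg) Vproj_horizontal0 ?subr0 //.
have VB : Vproj gM F (B Y) = B Y.
  by apply/funext => q; exact/Vproj_id/B_vertical.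
rewrite /A /oneillA (metricDl hg) HX VB metric_Hproj //.
rewrite (Defs.metric_sym hg _ (Vproj _ _ _ _)) hphi ?add0r //.
exact: Vproj_vertical.
Qed.

(** A_X V may be replaced with nabla_X V, since C Y is orthogonal to phi of
    vertical vectors.  The Kenmotsu identity then moves phi under nabla_X at
    the cost of a multiple of xi, to which C Y is orthogonal.  Differentiating
    g (C Y) (phi V) = 0 along X concludes. *)
Lemma oneillA_V X Y V p :
  section_of (horizontal gM F) X -> section_of (horizontal gM F) Y ->
  section_of (vertical F) V ->
  gM p (C Y p) (phi p (A X V p)) = - gM p (nablaM X (C Y) p) (phi p (V p)).
Proof.
move=> [sX hX] [sY hY] [sV vV].
have HX : Hproj gM F X = X.
  apply/funext => q; rewrite (HprojE sF rkF hg) Vproj_horizontal0 ?subr0 //.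
have VV : Vproj gM F V = V by apply/funext => q; exact: Vproj_id.
have -> : gM p (C Y p) (phi p (A X V p)) =
    gM p (C Y p) (phi p (nablaM X V p)).
  rewrite /A /oneillA HX VV (HprojE sF rkF hg).
  have va := Vproj_vertical sF rkF hg (nablaM X (Hproj gM F V)) p.
  have vb := Vproj_vertical sF rkF hg (nablaM X V) p.
  rewrite (linearD (phi p)) (linearB (phi p)) (metricDr hg) (metricBr hg).
  by rewrite (C_orth_phi (hY p) va) (C_orth_phi (hY p) vb) subr0 add0r.
have sC := smooth_C sY; have sphiV := smooth_phi sV.
have compat := lc_metric hlc sX sC sphiV p.
have gC0 : (fun q => gM q (C Y q) (phif V q)) = (fun=> 0).
  by apply/funext => q; exact: C_orth_phi.
rewrite gC0 lie_cst in compat.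
have -> : phi p (nablaM X V p) = nablaM X (phif V) p -
    (gM p (phi p (X p)) (V p) *: xi p - eta p (V p) *: phi p (X p)).
  by rewrite -(ken_nabla_phi hM sX sV) opprB addrC subrK.
rewrite (eta_vertical (vV p)) scale0r subr0 (metricBr hg) (metricZr hg).
rewrite -(acm_eta_dual hacm) eta_C mulr0 subr0.
by apply/eqP; rewrite -addr_eq0 addrC -compat.
Qed.

(** The correction terms of the Kenmotsu identity are multiples of xi and of
    phi X, and both are orthogonal to phi V because eta V = 0 and X is
    horizontal. *)
Lemma nabla_phi X Y V p :
  section_of (horizontal gM F) X -> section_of (horizontal gM F) Y ->
  section_of (vertical F) V ->
  gM p (nablaM X (phif Y) p) (phi p (V p)) = gM p (nablaM X Y p) (V p).
Proof.
move=> [sX hX] [sY hY] [sV vV].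
have -> : nablaM X (phif Y) p = phi p (nablaM X Y p) +
    (gM p (phi p (X p)) (Y p) *: xi p - eta p (Y p) *: phi p (X p)).
  by rewrite -(ken_nabla_phi hM sX sY) addrC subrK.
rewrite (metricDl hg) (metricBl hg) !(metricZl hg) !(acm_compat hacm).
rewrite (eta_vertical (vV p)) !mulr0 !subr0 (hX p _ (vV p)) mulr0 subr0.
rewrite (Defs.metric_sym hg _ (xi p)) -(acm_eta_dual hacm).
by rewrite (acm_eta_phi hacm) mulr0 addr0.
Qed.

Lemma nabla_phiD X Y p : smooth_field X -> smooth_field Y ->
  nablaM X (phif Y) p = nablaM X (B Y) p + nablaM X (C Y) p.
Proof.
move=> sX sY; rewrite phi_BC.
exact: (conn_addr hcon sX (smooth_B sY) (smooth_C sY)).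
Qed.

Lemma push_phi Y p : push F p (phi p (Y p)) = push F p (C Y p).
Proof. by rewrite C_E pushB // (B_vertical Y p) subr0. Qed.

Lemma nabla_BC X Y V p :
  section_of (horizontal gM F) X -> section_of (horizontal gM F) Y ->
  section_of (vertical F) V ->
  gM p (nablaM X (B Y) p) (phi p (V p)) + gM p (nablaM X (C Y) p) (phi p (V p))
  = gM p (nablaM X Y p) (V p).
Proof.
move=> sX sY sV; rewrite -(nabla_phi p sX sY sV) -(metricDl hg).
by have [mX _] := sX; have [mY _] := sY; rewrite nabla_phiD.
Qed.

(** For the converse it suffices to take for V the vertical part of nabla_X Y,
    which is a smooth section by smooth_Vproj; vectors need not be extended to
    vertical fields. *)
Lemma totally_geodesic_metric :
  totally_geodesic_foliation nablaM (horizontal gM F) <->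
  forall X Y V,
    section_of (horizontal gM F) X -> section_of (horizontal gM F) Y ->
    section_of (vertical F) V -> forall p, gM p (nablaM X Y p) (V p) = 0.
Proof.
split=> [tg X Y V sX sY [_ vV] p|H X Y sX sY].
  by have [_ h] := tg X Y sX sY; exact: h.
have [mX _] := sX; have [mY _] := sY.
have sW : smooth_field (nablaM X Y) by exact: (conn_smooth hcon).
split=> // p; pose W := Vproj gM F (nablaM X Y).
have hW : section_of (vertical F) W.
  split=> [|q]; [exact: smooth_Vproj|exact: Vproj_vertical].
have h : horizontal gM F p (nablaM X Y p - W p).
  exact: (Vproj_horizontal sF rkF hg).
have W0 : W p = 0.
  apply: (metric_eq0 hg (p := p)).
  have := h _ (Vproj_vertical sF rkF hg (nablaM X Y) p).
  rewrite (metricBl hg) (H X Y W sX sY hW) sub0r => /eqP.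
  by rewrite oppr_eq0 => /eqP.
by rewrite W0 subr0 in h.
Qed.

End anti_invariant_submersion.

Theorem theorem3 (R : realType) (m n : nat)
  (M : manifold R m.*2.+1) (N : manifold R n)
  (phi : M -> {linear 'rV[R]_(m.*2.+1) -> 'rV[R]_(m.*2.+1)})
  (xi : M -> 'rV[R]_(m.*2.+1))
  (eta : M -> {linear 'rV[R]_(m.*2.+1) -> R^o})
  (gM : M -> 'rV[R]_(m.*2.+1) -> 'rV[R]_(m.*2.+1) -> R)
  (gN : N -> 'rV[R]_n -> 'rV[R]_n -> R)
  (nablaM : (M -> 'rV[R]_(m.*2.+1)) -> (M -> 'rV[R]_(m.*2.+1)) ->
            M -> 'rV[R]_(m.*2.+1))
  (nablaN : (N -> 'rV[R]_n) -> (N -> 'rV[R]_n) -> N -> 'rV[R]_n)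
  (nablaF : (M -> 'rV[R]_(m.*2.+1)) -> (M -> 'rV[R]_n) -> M -> 'rV[R]_n)
  (F : M -> N)
  (hM : kenmotsu phi xi eta gM nablaM)
  (hgN : riemannian_metric gN)
  (hN : levi_civita gN nablaN)
  (hF : riemannian_submersion gM gN F)
  (hnablaF : pullback_connection F nablaN nablaF)
  (hanti : anti_invariant phi gM F)
  (hxi : forall p, horizontal gM F p (xi p)) :
  let A := oneillA gM F nablaM in
  let B := Bpart phi gM F in
  let C := Cpart phi gM F in
  let i := totally_geodesic_foliation nablaM (horizontal gM F) in
  let ii := forall X Y V : M -> 'rV[R]_(m.*2.+1),
    section_of (horizontal gM F) X -> section_of (horizontal gM F) Y ->
    section_of (vertical F) V ->
    forall p, gM p (A X (B Y) p) (phi p (V p)) = gM p (C Y p) (phi p (A X V p)) in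
  let iii := forall X Y V : M -> 'rV[R]_(m.*2.+1),
    section_of (horizontal gM F) X -> section_of (horizontal gM F) Y ->
    section_of (vertical F) V ->
    forall p,
      gN (F p)
        (second_fundamental_form F nablaM nablaF X (fun q => phi q (Y q)) p)
        (push F p (phi p (V p)))
      = - gM p (C Y p) (phi p (A X V p)) in
  (i <-> ii) /\ (ii <-> iii).
Proof.
move=> A B C i ii iii.
have hg := acm_metric (ken_acm hM); have hlc := ken_lc hM.
have sF := subm_smooth hF.
split.
  apply: (iff_trans (totally_geodesic_metric hM hF)).
  split=> H X Y V sX sY sV p.
    have := nabla_BC hM hF hxi p sX sY sV; rewrite (H X Y V) // => /eqP.
    rewrite addr_eq0 => /eqP E.
    by rewrite (oneillA_Bpart hM hF hanti p sX sY sV) E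
      (oneillA_V hM hF hanti hxi p sX sY sV).
  have := H X Y V sX sY sV p.
  rewrite (oneillA_Bpart hM hF hanti p sX sY sV).
  rewrite (oneillA_V hM hF hanti hxi p sX sY sV).
  by move=> E; rewrite -(nabla_BC hM hF hxi p sX sY sV) E addNr.
(* Only the vertical part B Y of phi Y contributes to the second fundamental
   form, because C Y is horizontal. *)
suff E X Y V p : section_of (horizontal gM F) X ->
    section_of (horizontal gM F) Y -> section_of (vertical F) V ->
    gN (F p)
      (second_fundamental_form F nablaM nablaF X (fun q => phi q (Y q)) p)
      (push F p (phi p (V p))) = - gM p (A X (B Y) p) (phi p (V p)).
  split=> H X Y V sX sY sV p.
    by rewrite (E X Y V p sX sY sV) (H X Y V sX sY sV p).
  by have := H X Y V sX sY sV p; rewrite (E X Y V) // => /oppr_inj.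
move=> sX sY sV; rewrite (oneillA_Bpart hM hF hanti p sX sY sV).
have sCY := C_section hM hF sY; have sphiV := phi_section hM hanti sV.
have S0 := second_fundamental_form_horizontal hg hgN hF hlc hN hnablaF p
  sX sCY sphiV.
have [mX _] := sX; have [mY _] := sY; have [_ hphiV] := sphiV.
have e : second_fundamental_form F nablaM nablaF X (fun q => phi q (Y q)) p =
    second_fundamental_form F nablaM nablaF X (C Y) p -
    push F p (nablaM X (B Y) p).
  have pE : (fun q => push F q (phi q (Y q))) = (fun q => push F q (C Y q)).
    by apply/funext => q; exact: (push_phi hM hF).
  rewrite /second_fundamental_form pE (nabla_phiD hM hF p mX mY).
  rewrite (pushD sF p (nablaM X (B Y) p) (nablaM X (C Y) p)).
  by rewrite [_ + push _ _ _]addrC opprD addrA.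
rewrite e (metricBl hgN) S0 sub0r; congr (- _).
exact: (push_isometry hg hgN hF _ (hphiV p)).
Qed.
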